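(* Let $n>2$ and consider the $n$-dimensional (pseudo-)Riemannian space with metric $$ds^2=dr^2+r^2h_{AB}\,dy^Ady^B,\qquad h_{AB}=h_{AB}(y^C),\quad A,B,C=1,\dots,n-1,$$ which admits the gradient homothetic vector $r\partial_r$. The homogeneous heat equation of this metric, $\Delta u-u_t=0$, i.e. $$u_{rr}+\frac{1}{r^2}h^{AB}u_{AB}+\frac{n-1}{r}u_r-\frac{1}{r^2}\Gamma^Au_A-u_t=0,$$ admits the Lie point symmetries generated by this gradient homothetic vector $$\bar X_1=2t\,\partial_t+r\,\partial_r,\qquad \bar X_2=t^2\partial_t+tr\,\partial_r-\left(\tfrac14 r^2+\tfrac n2 t\right)u\,\partial_u .$$ The reduction of the heat equation by means of these Lie symmetries leads to a Laplace equation. More precisely: (i) reduction by $\bar X_1$, with new variables $\phi=r/\sqrt t$, $y^A$ and $w(\phi,y^A)=u$, leads to ${}_{\bar g}\Delta w=0$, where ${}_{\bar g}\Delta$ is the Laplace operator of the metric $$d\bar s^2=\exp\left(\frac{\phi^2}{2(n-2)}\right)\left(d\phi^2+\phi^2h_{AB}\,dy^Ady^B\right);$$ (ii) reduction by $\bar X_2$, with new variables $\phi=r/t$, $y^A$ and $w(\phi,y^A)=u\,t^{n/2}e^{r^2/(4t)}$, leads to ${}_g\Delta w=0$, where ${}_g\Delta$ is the Laplace operator of the metric $$ds^2=d\phi^2+\phi^2h_{AB}\,dy^Ady^B .$$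
   Context: The Laplace operator of a metric $g_{ij}$ is $\Delta u=\frac{1}{\sqrt{|g|}}\partial_i\left(\sqrt{|g|}\,g^{ij}\partial_j u\right)$. Here $\Gamma^A=\Gamma^A_{BC}h^{BC}$, where $\Gamma^A_{BC}$ are the Christoffel symbols of $h_{AB}$, and subscripts on $u$ denote partial derivatives. A homothetic vector of $g$ is a vector field $\xi$ with $L_\xi g_{ij}=2\psi g_{ij}$ and $\psi=1$; it is gradient if $\xi_i=S_{,i}$ for a function $S$. Reduction of a PDE by a Lie point symmetry $X$ means passing to the zeroth order invariants of $X$ (functions $f$ of the independent and dependent variables with $X(f)=0$) as new variables: one seeks the solutions $u$ that correspond, through the stated formula for $w$, to a function $w$ of the invariant independent variables alone, and the reduced equation is the PDE (up to multiplication by a nowhere vanishing function) satisfied by $w$. *)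

(* Defs.v *)
From mathcomp Require Import all_boot all_order all_algebra.
From mathcomp Require Import all_classical all_reals all_analysis.

Set Implicit Arguments.
Unset Strict Implicit.
Unset Printing Implicit Defensive.

Import Order.TTheory GRing.Theory Num.Theory.
Import numFieldNormedType.Exports.

Local Open Scope classical_set_scope.
Local Open Scope ring_scope.

Section PartialDerivatives.
Context {R : realType} {p : nat}.

Definition basis_vec (i : 'I_p) : 'rV[R]_p := delta_mx 0 i.

Definition partial (i : 'I_p) (f : 'rV[R]_p -> R^o) : 'rV[R]_p -> R^o :=
  fun x => 'D_(basis_vec i) f x.

Definition iter_partial (s : seq 'I_p) (f : 'rV[R]_p -> R^o) :
    'rV[R]_p -> R^o :=
  foldr partial f s.

(* On an open set [D] this is the usual class C^k: partial derivatives of order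
   < k are of class C^1, hence Frechet differentiable. *)
Definition class_C (k : nat) (D : set 'rV[R]_p) (f : 'rV[R]_p -> R^o) : Prop :=
  (forall s, (size s < k)%N ->
     forall x, D x -> differentiable (iter_partial s f) x) /\
  (forall s, (size s <= k)%N ->
     forall x, D x -> {for x, continuous (iter_partial s f)}).

Definition smooth_on (D : set 'rV[R]_p) (f : 'rV[R]_p -> R^o) : Prop :=
  forall k, class_C k D f.

End PartialDerivatives.

Section Metrics.
Context {R : realType} {p : nat}.
Implicit Types (D : set 'rV[R]_p) (g : 'rV[R]_p -> 'M[R]_p).

(* A metric in local coordinates is its matrix of components; no signature is
   imposed. *)
Definition pseudo_metric_on D g : Prop :=
  [/\ forall i j, smooth_on D (fun x => g x i j),
      forall x, D x -> (g x)^T = g x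
    & forall x, D x -> g x \in unitmx].

Definition sqrt_abs_det g (x : 'rV[R]_p) : R := Num.sqrt `|\det (g x)|.

Definition laplacian g (u : 'rV[R]_p -> R^o) (x : 'rV[R]_p) : R :=
  (sqrt_abs_det g x)^-1 *
  \sum_i partial i
    (fun z => sqrt_abs_det g z * \sum_j invmx (g z) i j * partial j u z) x.

(* [christoffel g a b c x] is Gamma^a_{bc} at x *)
Definition christoffel g (a b c : 'I_p) (x : 'rV[R]_p) : R :=
  2^-1 * \sum_d invmx (g x) a d *
    (partial b (fun z => g z d c) x + partial c (fun z => g z d b) x
     - partial d (fun z => g z b c) x).

(* Gamma^a = Gamma^a_{bc} g^{bc} *)
Definition contracted_christoffel g (a : 'I_p) (x : 'rV[R]_p) : R :=
  \sum_b \sum_c christoffel g a b c x * invmx (g x) b c.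

Definition lie_derivative_metric g (xi : 'rV[R]_p -> 'rV[R]_p)
    (i j : 'I_p) (x : 'rV[R]_p) : R :=
  \sum_k (xi x 0 k * partial k (fun z => g z i j) x
          + g x k j * partial i (fun z => xi z 0 k) x
          + g x i k * partial j (fun z => xi z 0 k) x).

Definition homothetic_vector D g (xi : 'rV[R]_p -> 'rV[R]_p) : Prop :=
  forall x, D x -> forall i j,
    lie_derivative_metric g xi i j x = 2 * g x i j.

Definition gradient_vector D g (xi : 'rV[R]_p -> 'rV[R]_p) : Prop :=
  exists S : 'rV[R]_p -> R^o, forall x, D x -> forall i,
    is_derive x (basis_vec i) S (\sum_j g x i j * xi x 0 j).

End Metrics.

(* Second order jets of functions of [p] variables: a point of [jet0] is (x, u),
   of [jet1] is ((x, u), (u_i)), of [jet2] is (((x, u), (u_i)), (u_ij)). *)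
Definition jet0 (R : realType) (p : nat) : normedModType R :=
  ('rV[R]_p * R^o)%type.
Definition jet1 (R : realType) (p : nat) : normedModType R :=
  (jet0 R p * 'rV[R]_p)%type.
Definition jet2 (R : realType) (p : nat) : normedModType R :=
  (jet1 R p * 'M[R]_p)%type.

Section LieSymmetries.
Context {R : realType} {p : nat}.

Definition jet2_of (u : 'rV[R]_p -> R^o) (x : 'rV[R]_p) : jet2 R p :=
  ((x, u x, \row_i partial i u x),
   \matrix_(i, k) partial k (partial i u) x).

(* Total derivatives D_i = d_i + u_i d_u (+ u_ik d_{u_k}) *)
Definition total_derive0 (i : 'I_p) (f : jet0 R p -> R^o) (j : jet1 R p) : R :=
  'D_((basis_vec i, j.2 0 i) : jet0 R p) f j.1.

Definition total_derive1 (i : 'I_p) (f : jet1 R p -> R^o) (j : jet2 R p) : R :=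
  'D_((basis_vec i, j.1.2 0 i, row i j.2) : jet1 R p) f j.1.

(* A point vector field xi^i d_i + eta d_u is a map [X] with X (x, u) = (xi, eta). *)
Definition prolong1 (X : jet0 R p -> jet0 R p) (i : 'I_p) (j : jet1 R p) : R :=
  total_derive0 i (fun e => (X e).2) j
  - \sum_k j.2 0 k * total_derive0 i (fun e => (X e).1 0 k) j.

Definition prolong2 (X : jet0 R p -> jet0 R p) (i k : 'I_p) (j : jet2 R p) : R :=
  total_derive1 k (prolong1 X i) j
  - \sum_l j.2 i l * total_derive0 k (fun e => (X e).1 0 l) j.1.

Definition prolongation (X : jet0 R p -> jet0 R p) (j : jet2 R p) : jet2 R p :=
  ((X j.1.1, \row_i prolong1 X i j.1), \matrix_(i, k) prolong2 X i k j).

(* [X] generates a Lie point symmetry of the equation F(x, u, u_i, u_ij) = 0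
   over [D]: the second prolongation of X annihilates F modulo F = 0. *)
Definition lie_point_symmetry (D : set 'rV[R]_p) (F : jet2 R p -> R^o)
    (X : jet0 R p -> jet0 R p) : Prop :=
  forall j : jet2 R p, D j.1.1.1 -> (j.2)^T = j.2 -> F j = 0 ->
    is_derive j (prolongation X j) F 0.

Definition zeroth_order_invariant (D : set 'rV[R]_p)
    (X : jet0 R p -> jet0 R p) (f : jet0 R p -> R^o) : Prop :=
  forall e : jet0 R p, D e.1 -> is_derive e (X e) f 0.

End LieSymmetries.

(* The equation E u = 0 on [D] reduces by [X], with new independent variables
   z(x) and new dependent variable w = W(x, u), to E' w = 0 on [D']. *)
Definition reduces_by (R : realType) (p q : nat)
    (X : jet0 R p -> jet0 R p)
    (D : set 'rV[R]_p) (E : ('rV[R]_p -> R^o) -> 'rV[R]_p -> R)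
    (z : 'rV[R]_p -> 'rV[R]_q) (W : jet0 R p -> R^o)
    (D' : set 'rV[R]_q) (E' : ('rV[R]_q -> R^o) -> 'rV[R]_q -> R) : Prop :=
  [/\ forall k, zeroth_order_invariant D X (fun e => z e.1 0 k),
      zeroth_order_invariant D X W,
      z @` D = D',
      forall x, D x -> bijective (fun v : R => W (x, v))
    & exists mu : 'rV[R]_p -> R,
        (forall x, D x -> mu x != 0) /\
        forall (u : 'rV[R]_p -> R^o) (w : 'rV[R]_q -> R^o),
          class_C 2 D' w ->
          (forall x, D x -> w (z x) = W (x, u x)) ->
          (forall x, D x -> E u x = mu x * E' w (z x)) /\
          ((forall x, D x -> E u x = 0) <-> (forall y, D' y -> E' w y = 0))].

Section Cone.
Context {R : realType} {n : nat}.

(* For n > 0, n-dimensional space has coordinates (r, y) : 'rV_(1 + n.-1) and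
   space-time has coordinates (t, (r, y)) : 'rV_(1 + (1 + n.-1)). *)
Definition space_r (x : 'rV[R]_(1 + n.-1)) : R := lsubmx x 0 0.
Definition space_y (x : 'rV[R]_(1 + n.-1)) : 'rV[R]_n.-1 := rsubmx x.
Definition time (x : 'rV[R]_(1 + (1 + n.-1))) : R := lsubmx x 0 0.
Definition space (x : 'rV[R]_(1 + (1 + n.-1))) : 'rV[R]_(1 + n.-1) := rsubmx x.

Definition idx_t : 'I_(1 + (1 + n.-1)) := lshift _ ord0.
Definition idx_r : 'I_(1 + (1 + n.-1)) := rshift 1 (lshift _ ord0).
Definition idx_y (A : 'I_n.-1) : 'I_(1 + (1 + n.-1)) := rshift 1 (rshift 1 A).

Definition cone_domain (U : set 'rV[R]_n.-1) : set 'rV[R]_(1 + n.-1) :=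
  [set x | 0 < space_r x /\ U (space_y x)].

Definition spacetime_domain (U : set 'rV[R]_n.-1) :
    set 'rV[R]_(1 + (1 + n.-1)) :=
  [set x | cone_domain U (space x)].

Definition future_domain (U : set 'rV[R]_n.-1) :
    set 'rV[R]_(1 + (1 + n.-1)) :=
  [set x | 0 < time x /\ cone_domain U (space x)].

(* dr^2 + r^2 h_AB dy^A dy^B *)
Definition cone_metric (h : 'rV[R]_n.-1 -> 'M[R]_n.-1)
    (x : 'rV[R]_(1 + n.-1)) : 'M[R]_(1 + n.-1) :=
  block_mx 1%:M 0 0 (space_r x ^+ 2 *: h (space_y x)).

(* exp(phi^2 / (2 (n - 2))) (dphi^2 + phi^2 h_AB dy^A dy^B) *)
Definition conformal_cone_metric (h : 'rV[R]_n.-1 -> 'M[R]_n.-1)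
    (x : 'rV[R]_(1 + n.-1)) : 'M[R]_(1 + n.-1) :=
  expR (space_r x ^+ 2 / (2 * (n%:R - 2))) *: cone_metric h x.

(* The vector field r d_r *)
Definition radial_field (x : 'rV[R]_(1 + n.-1)) : 'rV[R]_(1 + n.-1) :=
  row_mx (space_r x)%:M 0.

(* Delta u - u_t, with Delta acting on the slices of constant t *)
Definition heat_operator (g : 'rV[R]_(1 + n.-1) -> 'M[R]_(1 + n.-1))
    (u : 'rV[R]_(1 + (1 + n.-1)) -> R^o) (x : 'rV[R]_(1 + (1 + n.-1))) : R :=
  laplacian g (fun s => u (row_mx (lsubmx x) s)) (space x) - partial idx_t u x.

(* u_rr + r^-2 h^AB u_AB + (n-1)/r u_r - r^-2 Gamma^A u_A - u_t *)
Definition heat_jet (h : 'rV[R]_n.-1 -> 'M[R]_n.-1)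
    (j : jet2 R (1 + (1 + n.-1))) : R :=
  let r := space_r (space j.1.1.1) in
  let y := space_y (space j.1.1.1) in
  let u1 := j.1.2 in
  let u2 := j.2 in
  u2 idx_r idx_r
  + (r ^+ 2)^-1 *
      (\sum_A \sum_B invmx (h y) A B * u2 (idx_y A) (idx_y B))
  + (n%:R - 1) / r * u1 0 idx_r
  - (r ^+ 2)^-1 * (\sum_A contracted_christoffel h A y * u1 0 (idx_y A))
  - u1 0 idx_t.

(* 2 t d_t + r d_r *)
Definition X1 (e : jet0 R (1 + (1 + n.-1))) : jet0 R (1 + (1 + n.-1)) :=
  (row_mx (2 * time e.1)%:M (radial_field (space e.1)), 0).

(* t^2 d_t + t r d_r - (r^2/4 + n t/2) u d_u *)
Definition X2 (e : jet0 R (1 + (1 + n.-1))) : jet0 R (1 + (1 + n.-1)) :=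
  (row_mx (time e.1 ^+ 2)%:M (time e.1 *: radial_field (space e.1)),
   - (4^-1 * space_r (space e.1) ^+ 2 + n%:R / 2 * time e.1) * e.2).

Definition new_coords1 (x : 'rV[R]_(1 + (1 + n.-1))) : 'rV[R]_(1 + n.-1) :=
  row_mx (space_r (space x) / Num.sqrt (time x))%:M (space_y (space x)).

Definition new_unknown1 (e : jet0 R (1 + (1 + n.-1))) : R := e.2.

Definition new_coords2 (x : 'rV[R]_(1 + (1 + n.-1))) : 'rV[R]_(1 + n.-1) :=
  row_mx (space_r (space x) / time x)%:M (space_y (space x)).

Definition new_unknown2 (e : jet0 R (1 + (1 + n.-1))) : R :=
  e.2 * time e.1 `^ (n%:R / 2)
      * expR (space_r (space e.1) ^+ 2 / (4 * time e.1)).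

End Cone.

(* Main.v *)
Require Import Defs.
From mathcomp Require Import all_boot all_order all_algebra.
From mathcomp Require Import all_classical all_reals all_analysis.
From mathcomp Require Import ring perm.
Import Order.TTheory GRing.Theory Num.Theory.
Import numFieldNormedType.Exports.
Local Open Scope classical_set_scope.
Local Open Scope ring_scope.

Set Implicit Arguments.
Unset Strict Implicit.
Unset Printing Implicit Defensive.
Import Defs.

(** In polar coordinates the Laplace operator of a cone dr^2 + r^2 h splits as
    f_rr + (n - 1) / r f_r + r^-2 (h^AB f_AB - Gamma^A f_A), because the density
    sqrt |g| = r^(n - 1) sqrt |h| factors ([laplacian_cone]). The angular part
    rests on the identity
    |h|^(-1/2) d_A (|h|^(1/2) h^AB) = - Gamma^B ([contracted_christoffelE]),
    that is, on Jacobi's formula for the derivative of a determinant. This gives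
    the explicit form of the heat operator ([heat_operatorE]).

    Neither symmetry moves the angles, so that h is never differentiated along
    the prolonged fields: the heat equation varies like one with constant
    coefficients in y. Prolonging al X2 + be X1 once covers X1 and X2, and the
    zeroth-order terms that it leaves cancel because 1 + (n - 1) = n
    ([heat_field_symmetry]).

    For the reductions, the solutions to look for have the form
    u = a(t, r) w(c(t) r, y). Dilations of the cone multiply its Laplace operator
    by a constant ([laplacian_scaled]), so that the heat operator of u is
    a c^2 (Laplacian of w) plus a multiple of w_phi and a multiple of w
    ([heat_operator_similarity]). For X2 the amplitude a is a Gaussian solution of
    the radial heat equation, which kills the multiple of w, and its radial
    logarithmic derivative kills the multiple of w_phi. For X1 the amplitude is 1
    and the drift phi / 2 w_phi is left; in dimension n > 2 a radial conformal
    factor absorbs any radial drift, and exp (phi^2 / (2 (n - 2))) absorbs this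
    one ([laplacian_conformal_cone]). *)

(** * Directional derivatives *)

Section DirectionalDerivatives.
Context {R : realType} {V : normedModType R}.
Implicit Types (f g : V -> R^o) (a v : V).

(** Directional derivatives only see the restriction to a line, so that each of
    them is an ordinary derivative at 0. *)
Lemma is_derive_line f a v (d : R) :
  is_derive a v f d <-> is_derive (0 : R) 1 (fun t : R => f (t *: v + a) : R^o) d.
Proof.
have E : 'D_v f a = 'D_1 (fun t : R => f (t *: v + a) : R^o) (0 : R).
  apply: (congr1 (fun F => lim (F @ 0^'))); apply/funext => t /=.
  by rewrite addr0 scale0r add0r [t%:A]mulr1.
split => -[d1 d2]; split.
- exact: (derivable1P _ _ _).1.
- by rewrite -E.
- exact: (derivable1P _ _ _).2.
- by rewrite E.
Qed.

Lemma is_derive_affine f a v (d : R) :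
  (forall t : R, f (t *: v + a) = t * d + f a) -> is_derive a v f d.
Proof.
move=> fE; apply/is_derive_line.
have -> : (fun t : R => f (t *: v + a) : R^o) =
    (d \*: (id : R -> R^o)) + cst (f a).
  by apply/funext => t; rewrite fE mulrC.
apply: is_derive_eq.
by rewrite addr0; exact: mulr1.
Qed.

Lemma is_derive_constant f a v :
  (forall t : R, f (t *: v + a) = f a) -> is_derive a v f 0.
Proof. by move=> fE; apply: is_derive_affine => t; rewrite mulr0 add0r. Qed.

Lemma is_derive_add f g a v (df dg : R) : is_derive a v f df ->
  is_derive a v g dg -> is_derive a v (fun x => f x + g x : R^o) (df + dg).
Proof. exact: is_deriveD. Qed.

Lemma is_derive_opp f a v (df : R) : is_derive a v f df ->
  is_derive a v (fun x => - f x : R^o) (- df).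
Proof. exact: is_deriveN. Qed.

Lemma is_derive_mul f g a v (df dg : R) : is_derive a v f df ->
  is_derive a v g dg ->
  is_derive a v (fun x => f x * g x : R^o) (f a * dg + df * g a).
Proof.
move=> Df Dg; apply: (is_derive_eq (is_deriveM Df Dg)).
by rewrite [df * _]mulrC.
Qed.

Lemma is_derive_scale c f a v (df : R) : is_derive a v f df ->
  is_derive a v (fun x => c * f x : R^o) (c * df).
Proof. exact: is_deriveZ. Qed.

Lemma is_derive_pow f n a v (df : R) : is_derive a v f df ->
  is_derive a v (fun x => f x ^+ n : R^o) (n%:R * f a ^+ n.-1 * df).
Proof.
have -> : (fun x => f x ^+ n : R^o) = f ^+ n.
  by apply/funext => x; rewrite fctE.
exact: is_deriveX.
Qed.

Lemma is_derive_inv f a v (df : R) : f a != 0 -> is_derive a v f df ->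
  is_derive a v (fun x => (f x)^-1 : R^o) (- (f a) ^- 2 * df).
Proof.
move=> fa0 [Df <-]; split; first exact: derivableV.
exact: deriveV.
Qed.

Lemma is_derive_comp_real (phi : R -> R) f a v (b df : R) :
  is_derive (f a) 1 phi b -> is_derive a v f df ->
  is_derive a v (fun x => phi (f x) : R^o) (b * df).
Proof.
move=> Dphi /is_derive_line Df; apply/is_derive_line.
apply: (@is_derive1_comp _ phi (fun t => f (t *: v + a))) => //.
by rewrite scale0r add0r.
Qed.

Lemma is_derive_sumr (I : Type) (r : seq I) (P : pred I) (F : I -> V -> R^o)
    a v (dF : I -> R) :
  (forall i, P i -> is_derive a v (F i) (dF i)) ->
  is_derive a v (fun x => \sum_(i <- r | P i) F i x : R^o)
    (\sum_(i <- r | P i) dF i).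
Proof.
move=> DF; have -> : (fun x => \sum_(i <- r | P i) F i x : R^o) =
    \sum_(i <- r | P i) F i.
  by apply/funext => x; rewrite fct_sumE.
by elim/big_ind2: _ => // *; [exact: is_derive_cst|exact: is_deriveD].
Qed.

(** Leibniz rule: one factor is differentiated at a time. *)
Lemma is_derive_prod n (F : 'I_n -> V -> R^o) a v (dF : 'I_n -> R) :
  (forall i, is_derive a v (F i) (dF i)) ->
  is_derive a v (fun x => \prod_i F i x : R^o)
    (\sum_k \prod_i (if i == k then dF i else F i a)).
Proof.
elim: n F dF => [|n IHn] F dF DF.
  rewrite big_ord0; apply: is_derive_constant => t.
  by rewrite !big_ord0.
under eq_fun do rewrite big_ord_recl.
apply: (is_derive_eq (is_derive_mul (DF ord0)
  (IHn _ _ (fun i => DF (lift ord0 i))))).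
rewrite addrC [RHS]big_ord_recl big_ord_recl eqxx /=; congr (_ * _ + _).
rewrite mulr_sumr; apply: eq_bigr => k _; rewrite big_ord_recl /=.
by congr (_ * _); apply: eq_bigr => i _; rewrite (inj_eq lift_inj).
Qed.

End DirectionalDerivatives.

(** Reads a derivative off the syntax of the function, given those of its atoms
    in the context. Instance resolution is bypassed, so that the result is made
    of ring operations only. *)
Ltac differentiate :=
  notypeclasses refine (@is_derive_eq _ _ _ _ _ _ _ _ _ _);
  [ repeat first
    [ eassumption
    | match goal with H : forall _, is_derive _ _ _ _ |- _ => exact: H end
    (* constants before products: no derivative of a constant is produced *)
    | notypeclasses refine (is_derive_cst _ _ _)
    | notypeclasses refine (is_derive_opp _)
    | notypeclasses refine (is_derive_add _ _)
    | notypeclasses refine (is_derive_scale _ _)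
    | notypeclasses refine (is_derive_mul _ _)
    | notypeclasses refine (is_derive_pow _ _) ]
  | rewrite /cst /= ].

(** * Derivatives of determinants and inverse matrices *)

Section MatrixDerivatives.
Context {R : realType} {V : normedModType R} {p : nat}.
Variables (M : V -> 'M[R]_p) (a v : V) (dM : 'M[R]_p).
Hypothesis M_derive : forall i j,
  is_derive a v (fun x => M x i j : R^o) (dM i j).

(** Jacobi's formula: the Leibniz rule replaces one row at a time by its
    derivative, and each determinant so obtained is expanded along that row. *)
Lemma is_derive_det : is_derive a v (fun x => \det (M x) : R^o)
  (\sum_i \sum_j cofactor (M a) i j * dM i j).
Proof.
pose B k : 'M[R]_p := \matrix_(i, j) if i == k then dM i j else M a i j.
have detB k : \sum_j cofactor (M a) k j * dM k j = \det (B k).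
  rewrite (expand_det_row _ k); apply: eq_bigr => j _.
  rewrite mxE eqxx mulrC; congr (_ * (_ * \det _)).
  by apply/matrixP => i l; rewrite !mxE eq_sym (negbTE (neq_lift _ _)).
have Ds (s : {perm 'I_p}) := is_derive_scale ((-1) ^+ s)
  (is_derive_prod (fun i => M_derive i (s i))).
apply: (is_derive_eq (is_derive_sumr _ (fun s (_ : xpredT s) => Ds s))).
under [RHS]eq_bigr do rewrite detB.
rewrite [RHS]exchange_big /=; apply: eq_bigr => s _.
rewrite mulr_sumr; apply: eq_bigr => k _; congr (_ * _).
by apply: eq_bigr => i _; rewrite mxE.
Qed.

End MatrixDerivatives.

Section InverseMatrixDerivatives.
Context {R : realType} {V : normedModType R} {p : nat}.
Variables (M : V -> 'M[R]_p) (a v : V) (dM : 'M[R]_p).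
Hypothesis M_derive : forall i j,
  is_derive a v (fun x => M x i j : R^o) (dM i j).
Hypothesis M_unit : \forall x \near a, M x \in unitmx.

Let Ma_unit : M a \in unitmx := nbhs_singleton M_unit.

Lemma is_derive_det_unit : is_derive a v (fun x => \det (M x) : R^o)
  (\det (M a) * \tr (invmx (M a) *m dM)).
Proof.
apply: (is_derive_eq (is_derive_det M_derive)).
rewrite [RHS]mulr_sumr exchange_big /=; apply: eq_bigr => j _.
rewrite mxE mulr_sumr; apply: eq_bigr => i _.
by rewrite /invmx Ma_unit !mxE mulrA mulrA divff ?mul1r// -unitfE -unitmxE.
Qed.

Lemma is_derive_sqrt_abs_det :
  is_derive a v (fun x => Num.sqrt `|\det (M x)| : R^o)
    (Num.sqrt `|\det (M a)| * (2^-1 * \tr (invmx (M a) *m dM))).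
Proof.
have d0 : \det (M a) != 0 by rewrite -unitfE -unitmxE.
(* |d| is read as sqrt (d^2), which avoids distinguishing the sign of d *)
under eq_fun do rewrite -sqrtr_sqr.
have s0 : 0 < \det (M a) ^+ 2 by rewrite exprn_even_gt0.
have s1 : 0 < Num.sqrt (\det (M a) ^+ 2) by rewrite sqrtr_gt0.
have D := is_derive_comp_real (f := fun x => \det (M x) ^+ 2 : R^o)
  (is_derive1_sqrt s0) (is_derive_pow 2 is_derive_det_unit).
apply: (is_derive_eq (is_derive_comp_real (f := fun x => Num.sqrt (\det (M x) ^+ 2)
  : R^o) (is_derive1_sqrt s1) D)).
rewrite sqrtr_sqr; set T := \tr _.
set s := Num.sqrt _.
have s2 : s ^+ 2 = `|\det (M a)| by rewrite sqr_sqrtr.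
have sn0 : s != 0 by rewrite sqrtr_eq0 -ltNge normr_gt0.
rewrite -s2 /=.
have s4 : \det (M a) * \det (M a) = s ^+ 4.
  by rewrite -expr2 -real_normK ?num_real// -s2 -exprM.
have -> : 2 * \det (M a) ^+ 1 * (\det (M a) * T) =
  2 * (\det (M a) * \det (M a)) * T by ring.
rewrite s4; field; exact: sn0.
Qed.

(** Cramer's rule makes the entries of the inverse derivable; their derivatives
    then follow by differentiating the product of the matrix and its inverse. *)
Lemma is_derive_invmx i j : is_derive a v (fun x => invmx (M x) i j : R^o)
  ((- (invmx (M a) *m dM *m invmx (M a))) i j).
Proof.
have inv_derivable k l : derivable (fun x => invmx (M x) k l : R^o) a v.
  have D := is_derive_mul (is_derive_inv _ is_derive_det_unit)
    (is_derive_scale ((-1) ^+ (l + k)) (@is_derive_det _ _ _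
      (fun x => row' l (col' k (M x))) a v (row' l (col' k dM)) _)).
  apply: ex_derive; apply: (near_eq_is_derive _ (D _ _)).
  - near=> x.
    have Mx : M x \in unitmx by near: x.
    by rewrite /invmx Mx !mxE.
  - by rewrite -unitfE -unitmxE.
  - move=> i' j'; rewrite !mxE.
    by under eq_fun do rewrite !mxE; exact: M_derive.
set N := fun x => invmx (M x).
pose dN := \matrix_(k, l) 'D_v (fun x => N x k l : R^o) a.
have N_derive k l : is_derive a v (fun x => N x k l : R^o) (dN k l).
  by rewrite mxE; apply: derivableP; exact: inv_derivable.
(* the product of M and its inverse is constant near a *)
have leibniz : M a *m dN + dM *m N a = 0.
  apply/matrixP => k l.
  have D := is_derive_sumr (index_enum 'I_p) (fun m (_ : xpredT m) =>
    is_derive_mul (M_derive k m) (N_derive m l)).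
  have C : is_derive a v (fun x => \sum_m M x k m * N x m l : R^o) 0.
    apply: (near_eq_is_derive _ (is_derive_cst (1%:M k l : R^o) a v)).
    near=> x.
    have Mx : M x \in unitmx by near: x.
    by rewrite -(mulmxV Mx) mxE.
  have := @derive_val _ _ _ _ _ _ _ D.
  rewrite (@derive_val _ _ _ _ _ _ _ C) => /esym.
  by rewrite big_split !mxE.
have -> : - (N a *m dM *m N a) = dN.
  apply/esym/eqP; rewrite -addr_eq0 -mulmxA -[dN]mul1mx -(mulVmx Ma_unit).
  by rewrite -mulmxA -mulmxDr leibniz mulmx0.
exact: N_derive.
Unshelve. all: by end_near. Qed.

End InverseMatrixDerivatives.

(** * The Laplace operator in terms of Christoffel symbols *)

Section Laplacian.
Context {R : realType} {p : nat}.
Variables (D : set 'rV[R]_p) (g : 'rV[R]_p -> 'M[R]_p).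
Hypotheses (D_open : open D) (g_metric : pseudo_metric_on D g).

Definition partial_metric (i : 'I_p) (x : 'rV[R]_p) : 'M[R]_p :=
  \matrix_(k, l) partial i (fun z => g z k l) x.

Let g_sym x (Dx : D x) : (g x)^T = g x.
Proof. by case: g_metric => _ H _; exact: H. Qed.

Let g_unit x (Dx : D x) : g x \in unitmx.
Proof. by case: g_metric => _ _; exact. Qed.

Lemma is_derive_metric x (Dx : D x) i k l :
  is_derive x (basis_vec i) (fun z => g z k l : R^o) (partial_metric i x k l).
Proof.
case: g_metric => g_smooth _ _; rewrite mxE; apply: derivableP.
by apply: diff_derivable; exact: ((g_smooth k l 1%N).1 [::]).
Qed.

Lemma invmx_metric_sym x (Dx : D x) i j : invmx (g x) i j = invmx (g x) j i.
Proof.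
rewrite -{1}(g_sym Dx).
by rewrite -trmx_inv mxE.
Qed.

Let near_g_unit x (Dx : D x) : \forall z \near x, g z \in unitmx.
Proof.
by have := open_nbhs_nbhs (conj D_open Dx); apply: filterS => z; exact: g_unit.
Qed.

(** The divergence of the inverse metric with respect to the volume density
    [sqrt |g|]: the derivative of the inverse contributes two of the three terms
    of the Christoffel symbols, that of the density contributes the third. *)
Lemma contracted_christoffelE x (Dx : D x) a :
  contracted_christoffel g a x =
  \sum_i ((invmx (g x) *m partial_metric i x *m invmx (g x)) i a
    - 2^-1 * \tr (invmx (g x) *m partial_metric i x) * invmx (g x) i a).
Proof.
have Gsym i k l : partial_metric i x k l = partial_metric i x l k.
  rewrite !mxE; apply: near_eq_derive.
  have := open_nbhs_nbhs (conj D_open Dx); apply: filterS => z Dz.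
  by rewrite -{1}(g_sym Dz) mxE.
set G := partial_metric in Gsym *; set N := invmx (g x).
have Nsym i j : N i j = N j i by exact: invmx_metric_sym.
(* the three terms of Gamma^a contribute S, S again and - T *)
pose S := \sum_b \sum_c \sum_d N a d * G b x d c * N b c.
pose T := \sum_b \sum_c \sum_d N a d * G d x b c * N b c.
have -> : contracted_christoffel g a x = 2^-1 * (S + S - T).
  have ES : S = \sum_b \sum_c \sum_d N a d * G c x d b * N b c.
    rewrite /S exchange_big /=; apply: eq_bigr => b _; apply: eq_bigr => c _.
    by apply: eq_bigr => d _; rewrite [N c b]Nsym.
  rewrite {2}ES /S /T -big_split -sumrB mulr_sumr; apply: eq_bigr => b _ /=.
  rewrite -big_split -sumrB mulr_sumr; apply: eq_bigr => c _ /=.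
  rewrite -big_split -sumrB /christoffel -mulrA mulr_suml; congr (_ * _).
  by apply: eq_bigr => d _; rewrite /G !mxE -/N /=; ring.
rewrite sumrB.
have -> : \sum_i (N *m G i x *m N) i a = S.
  apply: eq_bigr => i _; rewrite mxE; under eq_bigr do rewrite mxE mulr_suml.
  rewrite /= [RHS]exchange_big /=; apply: eq_bigr => d _.
  by apply: eq_bigr => c _; rewrite Gsym [N d a]Nsym; ring.
have -> : \sum_i 2^-1 * \tr (N *m G i x) * N i a = 2^-1 * T.
  rewrite /T; under [in RHS]eq_bigr do rewrite exchange_big /=.
  rewrite [in RHS]exchange_big mulr_sumr; apply: eq_bigr => i _ /=.
  rewrite -mulrA; congr (_ * _); rewrite mulr_suml exchange_big /=.
  under eq_bigr do rewrite mxE mulr_suml.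
  rewrite exchange_big /=; apply: eq_bigr => b _; apply: eq_bigr => c _.
  by rewrite [N i a]Nsym [N c b]Nsym Gsym; ring.
by field.
Qed.

Section Functions.
Variables (f : 'rV[R]_p -> R^o) (x : 'rV[R]_p).
Hypotheses (Dx : D x) (f_derivable : forall i j,
  derivable (partial j f) x (basis_vec i)).

(** The summands of the Laplace operator, with the density kept as a factor. *)
Lemma is_derive_flux i : is_derive x (basis_vec i)
  (fun z => sqrt_abs_det g z * \sum_j invmx (g z) i j * partial j f z : R^o)
  (sqrt_abs_det g x *
    (\sum_j invmx (g x) i j * partial i (partial j f) x -
     \sum_j ((invmx (g x) *m partial_metric i x *m invmx (g x)) i j
      - 2^-1 * \tr (invmx (g x) *m partial_metric i x) * invmx (g x) i j)
      * partial j f x)).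
Proof.
have Ds := is_derive_sqrt_abs_det (is_derive_metric Dx i) (near_g_unit Dx).
have DN j := is_derive_invmx (is_derive_metric Dx i) (near_g_unit Dx) i j.
have Df j := derivableP (@f_derivable i j).
apply: (is_derive_eq (is_derive_mul Ds (is_derive_sumr (index_enum 'I_p)
  (fun j (_ : xpredT j) => is_derive_mul (DN j) (Df j))))).
rewrite -/(sqrt_abs_det g x) -mulrA -mulrDr; congr (_ * _).
rewrite mulr_sumr -big_split -sumrB; apply: eq_bigr => j _ /=.
by rewrite [in X in _ + X * _ + _]mxE /partial; ring.
Qed.

End Functions.
End Laplacian.

(** * The Laplace operator of a cone *)

Lemma invmx_uniq (R : comUnitRingType) m (A B : 'M[R]_m) :
  A *m B = 1%:M -> invmx A = B.
Proof.
move=> AB1; have [Au _] := mulmx1_unit AB1.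
by rewrite -[LHS]mulmx1 -AB1 mulKmx.
Qed.

Section Slices.
Context {R : realType} {m p : nat}.
Implicit Types (f : 'rV[R]_(m + p) -> R^o) (a : 'rV[R]_m) (y : 'rV[R]_p).

Lemma basis_rshift i : basis_vec (rshift m i) = row_mx 0 (basis_vec i) :> 'rV[R]_(m + p).
Proof.
apply/rowP => k; rewrite mxE eqxx /=; case: (split_ordP k) => j ->.
  by rewrite row_mxEl mxE eq_lrshift.
by rewrite row_mxEr mxE eqxx eq_rshift.
Qed.

Lemma row_mxZD t a y a' y' : t *: row_mx a y + row_mx a' y' =
  row_mx (t *: a + a') (t *: y + y') :> 'rV[R]_(m + p).
Proof. by rewrite scale_row_mx add_row_mx. Qed.

Lemma is_derive_slice f a y i d :
  is_derive (row_mx a y) (basis_vec (rshift m i)) f d ->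
  is_derive y (basis_vec i) (fun z => f (row_mx a z) : R^o) d.
Proof.
move=> /is_derive_line D; apply/is_derive_line; move: D.
by under eq_fun do rewrite basis_rshift row_mxZD scaler0 add0r.
Qed.

(** The difference quotients coincide, so that the equality holds whether or not
    they converge. *)
Lemma partial_slice f a i : partial i (fun y => f (row_mx a y)) =
  fun y => partial (rshift m i) f (row_mx a y).
Proof.
apply/funext => y; rewrite /partial /derive.
apply: (congr1 (fun F => lim (F @ 0^'))); apply/funext => t /=.
by rewrite basis_rshift row_mxZD scaler0 add0r.
Qed.

Lemma open_pos_first (O : set 'rV[R]_p) : open O ->
  open [set x : 'rV[R]_(1 + p) | 0 < lsubmx x 0 0 /\ O (rsubmx x)].
Proof.
move=> O_open.
have first_cont : continuous (fun x : 'rV[R]_(1 + p) => lsubmx x 0 0 : R).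
  move=> x; apply: (@continuous_comp _ _ _
    (lsubmx : 'M[R]_(1, 1 + p) -> 'M[R]_(1, 1)) (fun A : 'M[R]_(1, 1) => A 0 0)).
    exact: continuous_lsubmx.
  exact: coord_continuous.
have rest_cont : continuous (rsubmx : 'rV[R]_(1 + p) -> 'rV[R]_p).
  exact: continuous_rsubmx.
apply: openI.
  exact: (@open_comp _ _ (fun x : 'rV[R]_(1 + p) => lsubmx x 0 0 : R)
    [set t : R | 0 < t] (fun x _ => first_cont x) (@open_gt _ _)).
exact: (open_comp (fun x _ => rest_cont x) O_open).
Qed.

End Slices.

Section ConeCoordinates.
Context {R : realType} {n : nat}.
Implicit Types (x : 'rV[R]_(1 + n.-1)) (r : R) (y : 'rV[R]_n.-1).

Definition cone_point r y : 'rV[R]_(1 + n.-1) := row_mx r%:M y.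

Definition radial : 'I_(1 + n.-1) := lshift n.-1 ord0.
Definition angular (A : 'I_n.-1) : 'I_(1 + n.-1) := rshift 1 A.

Lemma cone_pointK x : cone_point (space_r x) (space_y x) = x.
Proof. by rewrite /cone_point -mx11_scalar hsubmxK. Qed.

Lemma space_r_point r y : space_r (cone_point r y) = r.
Proof. by rewrite /space_r row_mxKl !mxE eqxx. Qed.

Lemma space_y_point r y : space_y (cone_point r y) = y.
Proof. exact: row_mxKr. Qed.

Lemma space_rD t x x' : space_r (t *: x + x') = t * space_r x + space_r x'.
Proof. by rewrite /space_r !mxE. Qed.

Lemma space_yD t x x' : space_y (t *: x + x') = t *: space_y x + space_y x'.
Proof. by apply/rowP => A; rewrite !mxE. Qed.

Lemma basis_radial : basis_vec radial = cone_point (1 : R) 0.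
Proof.
apply/rowP => k; rewrite mxE eqxx /=.
case: (split_ordP k) => [i ->|A ->].
  by rewrite [i]ord1 row_mxEl mxE !eqxx.
by rewrite row_mxEr mxE eq_rlshift.
Qed.

Lemma basis_angular A : basis_vec (angular A) = cone_point (0 : R) (basis_vec A).
Proof. by rewrite basis_rshift /cone_point raddf0. Qed.

Lemma cone_pointD t r y r' y' :
  t *: cone_point r y + cone_point r' y' = cone_point (t * r + r') (t *: y + y').
Proof. by rewrite -[LHS]cone_pointK space_rD space_yD !space_r_point !space_y_point. Qed.

Lemma sum_cone (F : 'I_(1 + n.-1) -> R) :
  \sum_i F i = F radial + \sum_A F (angular A).
Proof. by rewrite big_split_ord big_ord1. Qed.

Lemma space_r_radial : space_r (basis_vec radial) = 1 :> R.
Proof. by rewrite basis_radial space_r_point. Qed.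

Lemma space_y_radial : space_y (basis_vec radial) = 0 :> 'rV[R]_n.-1.
Proof. by rewrite basis_radial space_y_point. Qed.

Lemma space_r_angular A : space_r (basis_vec (angular A)) = 0 :> R.
Proof. by rewrite basis_angular space_r_point. Qed.

Lemma space_y_angular A :
  space_y (basis_vec (angular A)) = basis_vec A :> 'rV[R]_n.-1.
Proof. by rewrite basis_angular space_y_point. Qed.

Lemma is_derive_space_r x v : is_derive x v (space_r : _ -> R^o) (space_r v).
Proof. by apply: is_derive_affine => t; rewrite space_rD. Qed.

Lemma is_derive_angular (F : R -> 'rV[R]_n.-1 -> R^o) x A d :
  is_derive (space_y x) (basis_vec A) (F (space_r x)) d ->
  is_derive x (basis_vec (angular A)) (fun z => F (space_r z) (space_y z) : R^o) d.
Proof.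
move=> /is_derive_line D; apply/is_derive_line.
under eq_fun do
  rewrite space_rD space_yD space_r_angular space_y_angular mulr0 add0r.
exact: D.
Qed.

Lemma is_derive_radial (F : R -> 'rV[R]_n.-1 -> R^o) x d :
  is_derive (space_r x) 1 (F ^~ (space_y x) : R -> R^o) d ->
  is_derive x (basis_vec radial) (fun z => F (space_r z) (space_y z) : R^o) d.
Proof.
move=> /is_derive_line D; apply/is_derive_line.
under eq_fun do
  rewrite space_rD space_yD space_r_radial space_y_radial scaler0 add0r.
exact: D.
Qed.

Lemma open_cone_domain (U : set 'rV[R]_n.-1) : open U -> open (cone_domain U).
Proof. exact: open_pos_first. Qed.

End ConeCoordinates.

Section WarpedCone.
Context {R : realType} {n : nat}.
Variables (U : set 'rV[R]_n.-1) (h : 'rV[R]_n.-1 -> 'M[R]_n.-1).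
Hypotheses (U_open : open U) (h_metric : pseudo_metric_on U h).

(** The two metrics at hand are radial conformal multiples of the cone metric;
    the conformal factor is a square so that the volume density of the multiple
    involves no root of it. *)
Definition warped_cone_metric (q : R -> R) (x : 'rV[R]_(1 + n.-1)) :=
  q (space_r x) ^+ 2 *: cone_metric h x.

Variable q : R -> R.
Hypothesis q_gt0 : forall r, 0 < r -> 0 < q r.

Let h_unit y (Uy : U y) : h y \in unitmx.
Proof. by case: h_metric => _ _; exact. Qed.

Lemma sqrt_abs_det_warped x : cone_domain U x ->
  sqrt_abs_det (warped_cone_metric q) x =
  q (space_r x) ^+ (1 + n.-1) * space_r x ^+ n.-1 * sqrt_abs_det h (space_y x).
Proof.
move=> [r_gt0 _]; have q0 := q_gt0 r_gt0.
rewrite /sqrt_abs_det /warped_cone_metric detZ det_ublock det1 mul1r detZ.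
rewrite !normrM !normrX (gtr0_norm q0) (gtr0_norm r_gt0).
rewrite mulrA; have -> : (q (space_r x) ^+ 2) ^+ (1 + n.-1) *
    (space_r x ^+ 2) ^+ n.-1 =
    (q (space_r x) ^+ (1 + n.-1) * space_r x ^+ n.-1) ^+ 2.
  by rewrite [RHS]exprMn; congr (_ * _); rewrite exprAC.
rewrite sqrtrM ?sqr_ge0// sqrtr_sqr [`|_ * _|]gtr0_norm//.
by rewrite mulr_gt0// exprn_gt0.
Qed.

Lemma invmx_warped x : cone_domain U x ->
  invmx (warped_cone_metric q x) =
  q (space_r x) ^- 2 *: block_mx 1%:M 0 0 (space_r x ^- 2 *: invmx (h (space_y x))).
Proof.
move=> [r_gt0 Uy]; have q0 := q_gt0 r_gt0; apply: invmx_uniq.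
rewrite /warped_cone_metric -scalemxAl -scalemxAr scalerA divff ?scale1r.
  rewrite mulmx_block !mulmx0 !mul0mx mul1mx !addr0 add0r.
  rewrite -scalemxAl -scalemxAr scalerA divff ?scale1r ?expf_neq0 ?gt_eqF//.
  by rewrite mulmxV ?h_unit// -scalar_mx_block.
by rewrite expf_neq0 ?gt_eqF.
Qed.

Variables (f : 'rV[R]_(1 + n.-1) -> R^o) (x : 'rV[R]_(1 + n.-1)) (dq : R).
Hypotheses (Dx : cone_domain U x)
  (q_derive : is_derive (space_r x) 1 (q : R -> R^o) dq)
  (f_rr_derivable : derivable (partial radial f) x (basis_vec radial))
  (f_AB_derivable : forall A B,
    derivable (partial (angular B) f) x (basis_vec (angular A))).

Let r := space_r x.
Let y := space_y x.

Let flux i (z : 'rV[R]_(1 + n.-1)) : R^o :=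
  sqrt_abs_det (warped_cone_metric q) z *
  \sum_j invmx (warped_cone_metric q z) i j * partial j f z.

Let near_cone : \forall z \near x, cone_domain U z.
Proof.
exact: (open_nbhs_nbhs (conj (open_cone_domain U_open) Dx)).
Qed.

Let r_gt0 : 0 < r. Proof. by case: Dx. Qed.
Let Uy : U y. Proof. by case: Dx. Qed.

(** In the radial direction h is constant: the function differentiated is
    q^(n - 2) r^(n - 1) f_r, up to a constant. *)
Lemma is_derive_radial_flux : is_derive x (basis_vec radial) (flux radial)
  (sqrt_abs_det (warped_cone_metric q) x * (q r ^- 2 *
    (partial radial (partial radial f) x
     + (n.-1%:R / r + (n.-1%:R - 1) * (dq / q r)) * partial radial f x))).
Proof.
have qr := q_gt0 r_gt0.
have Dr := is_derive_space_r x (basis_vec radial).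
rewrite space_r_radial in Dr.
have Dq := is_derive_comp_real (f := space_r) q_derive Dr.
have Ds : is_derive x (basis_vec radial)
    (fun z => sqrt_abs_det h (space_y z) : R^o) 0.
  apply: is_derive_constant => t.
  by rewrite space_yD space_y_radial scaler0 add0r.
have q2 : q (space_r x) ^+ 2 != 0 by rewrite expf_neq0 ?gt_eqF.
have D := is_derive_mul (is_derive_mul (is_derive_mul
    (is_derive_pow (1 + n.-1) Dq) (is_derive_pow n.-1 Dr)) Ds)
  (is_derive_mul (is_derive_inv (f := fun z => q (space_r z) ^+ 2 : R^o) q2
    (is_derive_pow 2 Dq)) (derivableP f_rr_derivable)).
apply: (near_eq_is_derive (f := fun z => _ : R^o) _ (is_derive_eq D _)).
  apply: filterS near_cone => z Dz.
  rewrite /flux (sqrt_abs_det_warped Dz) (invmx_warped Dz) sum_cone.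
  rewrite big1 ?addr0 => [|A _]; first by rewrite mxE block_mxEul mxE eqxx mulr1.
  by rewrite mxE block_mxEur mxE mulr0 mul0r.
(* dividing by r avoids the exponent n - 2, truncated when n = 1 *)
have predE : n.-1%:R * r ^+ n.-1.-1 = n.-1%:R * r ^+ n.-1 / r.
  by case: n.-1 => [|k]; rewrite ?mul0r// exprSr mulrA mulfK// gt_eqF.
rewrite sqrt_abs_det_warped// -/r -/y -/(partial radial (partial radial f) x).
move: (partial radial (partial radial f) x) (partial radial f x) => f_rr f_r.
rewrite add1n /= exprS !mulr1 predE -natr1.
field.
by rewrite !gt_eqF.
Qed.

(** In the angular directions q and r are constant: the flux is a constant
    multiple of the flux of the restriction of [f] to the cross-section through
    [x], for the metric [h]. *)
Lemma is_derive_angular_flux A : is_derive x (basis_vec (angular A))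
  (flux (angular A))
  (sqrt_abs_det (warped_cone_metric q) x * (q r ^- 2 * (r ^- 2 *
    (\sum_B invmx (h y) A B * partial (angular A) (partial (angular B) f) x -
     \sum_B ((invmx (h y) *m partial_metric h A y *m invmx (h y)) A B
      - 2^-1 * \tr (invmx (h y) *m partial_metric h A y) * invmx (h y) A B)
      * partial (angular B) f x)))).
Proof.
pose k s := q s ^+ (1 + n.-1) * s ^+ n.-1 * (q s ^- 2 * s ^- 2).
pose F s (z : 'rV[R]_n.-1) : R^o := sqrt_abs_det h z *
  \sum_B invmx (h z) A B * partial B (fun z => f (row_mx s%:M z)) z.
have f'_derivable B C : derivable
    (partial C (fun z => f (row_mx r%:M z))) y (basis_vec B).
  rewrite partial_slice.
  have := derivableP (@f_AB_derivable B C).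
  by rewrite -{1}(cone_pointK x) => /is_derive_slice [].
have kE (a b c e S : R) : a * (b * c) * (e * S) = a * e * (b * (c * S)) by ring.
have := is_derive_scale (k r) (is_derive_flux U_open h_metric Uy f'_derivable A).
have slice1 B : partial B (fun z => f (row_mx r%:M z)) y =
    partial (angular B) f x by rewrite partial_slice [row_mx _ _]cone_pointK.
have slice2 B : partial A (partial B (fun z => f (row_mx r%:M z))) y =
    partial (angular A) (partial (angular B) f) x.
  by rewrite !partial_slice [row_mx _ _]cone_pointK.
have E1 : \sum_B invmx (h y) A B *
      partial A (partial B (fun z => f (row_mx r%:M z))) y =
    \sum_B invmx (h y) A B * partial (angular A) (partial (angular B) f) x.
  by apply: eq_bigr => B _; rewrite slice2.
have E2 (c : 'I_n.-1 -> R) :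
    \sum_B c B * partial B (fun z => f (row_mx r%:M z)) y =
    \sum_B c B * partial (angular B) f x.
  by apply: eq_bigr => B _; rewrite slice1.
move=> DF0.
have DF : is_derive y (basis_vec A) (fun z => k r * F r z : R^o) _ :=
  is_derive_eq DF0 (congr2 (fun S1 S2 => k r * (sqrt_abs_det h y * (S1 - S2)))
    E1 (E2 _)).
have D := is_derive_angular (F := fun s z => k s * F s z) DF.
have fluxE z : cone_domain U z ->
    k (space_r z) * F (space_r z) (space_y z) = flux (angular A) z.
  move=> Dz; rewrite /flux (sqrt_abs_det_warped Dz) (invmx_warped Dz) sum_cone.
  rewrite mxE block_mxEdl mxE mulr0 mul0r add0r /F /k.
  set S := (X in _ * (_ * X) = _).
  rewrite [in RHS](_ : \sum_A _ = q (space_r z) ^- 2 * (space_r z ^- 2 * S)).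
    exact: kE.
  rewrite !mulr_sumr; apply: eq_bigr => B _.
  by rewrite mxE block_mxEdr mxE partial_slice [row_mx _ _]cone_pointK !mulrA.
apply: (near_eq_is_derive (filterS fluxE near_cone)).
apply: (is_derive_eq D).
by rewrite (sqrt_abs_det_warped Dx) /k kE.
Qed.

(** Both fluxes have the volume density as a factor, which cancels. *)
Lemma laplacian_warped : laplacian (warped_cone_metric q) f x =
  q r ^- 2 *
    (partial radial (partial radial f) x
     + (n.-1%:R / r + (n.-1%:R - 1) * (dq / q r)) * partial radial f x
     + r ^- 2 *
       (\sum_A \sum_B invmx (h y) A B
          * partial (angular A) (partial (angular B) f) x
        - \sum_A contracted_christoffel h A y * partial (angular A) f x)).
Proof.
have s0 : sqrt_abs_det (warped_cone_metric q) x != 0.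
  rewrite sqrt_abs_det_warped// !mulf_neq0 ?expf_neq0 ?gt_eqF ?q_gt0//.
  by rewrite sqrtr_gt0 normr_gt0 -unitfE -unitmxE h_unit.
rewrite /laplacian sum_cone.
under eq_bigr => A _ do
  rewrite /partial (@derive_val _ _ _ _ _ _ _ (is_derive_angular_flux A)).
rewrite {1}/partial (@derive_val _ _ _ _ _ _ _ is_derive_radial_flux).
rewrite -mulr_sumr -mulrDr mulKf// -mulr_sumr -mulrDr -mulr_sumr.
congr (_ * (_ + _ * _)); rewrite sumrB; congr (_ - _).
rewrite exchange_big /=; apply: eq_bigr => A _.
by rewrite (contracted_christoffelE U_open h_metric Uy) mulr_suml.
Qed.

End WarpedCone.

Lemma natr_pred (R : pzRingType) n : (0 < n)%N -> n.-1%:R = n%:R - 1 :> R.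
Proof. by move=> n_gt0; rewrite -subn1 natrB. Qed.

Section Cone.
Context {R : realType} {n : nat}.
Variables (U : set 'rV[R]_n.-1) (h : 'rV[R]_n.-1 -> 'M[R]_n.-1).
Hypotheses (U_open : open U) (h_metric : pseudo_metric_on U h).
Implicit Types (f w : 'rV[R]_(1 + n.-1) -> R^o) (x : 'rV[R]_(1 + n.-1)).

(** The Laplace operator of [h] on the cross-sections of the cone. *)
Definition angular_laplacian w x : R :=
  \sum_A \sum_B invmx (h (space_y x)) A B
    * partial (angular A) (partial (angular B) w) x
  - \sum_A contracted_christoffel h A (space_y x) * partial (angular A) w x.

Lemma laplacian_cone f x : cone_domain U x ->
  derivable (partial radial f) x (basis_vec radial) ->
  (forall A B, derivable (partial (angular B) f) x (basis_vec (angular A))) ->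
  laplacian (cone_metric h) f x =
    partial radial (partial radial f) x
    + n.-1%:R / space_r x * partial radial f x
    + space_r x ^- 2 * angular_laplacian f x.
Proof.
move=> Dx f_rr f_AB.
have -> : cone_metric h = warped_cone_metric h (fun=> 1).
  by apply/funext => z; rewrite /warped_cone_metric expr1n scale1r.
rewrite (laplacian_warped U_open h_metric _ Dx (is_derive_cst _ _ _) f_rr f_AB).
  by rewrite expr1n invr1 mul1r mul0r mulr0 addr0.
by move=> r _; exact: ltr01.
Qed.

(** Multiplying the metric by q^2 multiplies the density by q^n and the inverse
    metric by q^-2; their product q^(n - 2) is differentiated, which adds the drift
    (n - 2) (q' / q) f_r. With q = exp (r^2 / (4 (n - 2))) this is r / 2 f_r. *)
Lemma laplacian_conformal_cone f x : (2 < n)%N -> cone_domain U x ->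
  derivable (partial radial f) x (basis_vec radial) ->
  (forall A B, derivable (partial (angular B) f) x (basis_vec (angular A))) ->
  laplacian (conformal_cone_metric h) f x =
    (expR (space_r x ^+ 2 / (2 * (n%:R - 2))))^-1 *
    (laplacian (cone_metric h) f x + space_r x / 2 * partial radial f x).
Proof.
move=> n_gt2 Dx f_rr f_AB.
have n2 : n%:R - 2 != 0 :> R by rewrite subr_eq0 eqr_nat gtn_eqF.
pose q (r : R) : R := expR (r ^+ 2 / (4 * (n%:R - 2))).
have q2 r : q r ^+ 2 = expR (r ^+ 2 / (2 * (n%:R - 2))).
  by rewrite /q -expRM_natl; congr expR; field.
have -> : conformal_cone_metric h = warped_cone_metric h q.
  by apply/funext => z; rewrite /warped_cone_metric q2.
have Dq : is_derive (space_r x) 1 (q : R -> R^o)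
    (q (space_r x) * (space_r x / (2 * (n%:R - 2)))).
  have D := is_derive_mul (is_derive_pow 2 (is_derive_id (space_r x) (1 : R^o)))
    (is_derive_cst ((4 * (n%:R - 2))^-1 : R^o) (space_r x) (1 : R^o)).
  apply: (is_derive_eq (is_derive_comp_real (is_derive_expR _) D)).
  rewrite /cst /= mulr0 add0r mulr1 expr1; congr (_ * _); field; exact: n2.
rewrite (laplacian_warped U_open h_metric _ Dx Dq f_rr f_AB); last first.
  by move=> r _; exact: expR_gt0.
rewrite (laplacian_cone Dx f_rr f_AB) q2 natr_pred ?(ltnW (ltnW n_gt2))//.
rewrite -/(angular_laplacian f x).
have r0 : space_r x != 0 by case: Dx => r0 _; rewrite gt_eqF.
have q0 : q (space_r x) != 0 by rewrite gt_eqF ?expR_gt0.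
move: (partial radial (partial radial f) x) => f_rr'.
congr (_ * _); field.
by rewrite q0 r0 n2.
Qed.

Lemma is_derive_radial_comp (V : normedModType R) (s : V -> R^o) a v ds y w d :
  is_derive a v s ds ->
  is_derive (cone_point (s a) y) (basis_vec radial) w d ->
  is_derive a v (fun z => w (cone_point (s z) y) : R^o) (d * ds).
Proof.
move=> Ds /is_derive_line Dw.
apply: (@is_derive_comp_real _ _ (fun r => w (cone_point r y))) => //.
apply/is_derive_line; move: Dw.
by under eq_fun do rewrite basis_radial cone_pointD mulr1 scaler0 add0r;
  under [in X in _ -> X]eq_fun do rewrite [_ *: _]mulr1.
Qed.

Section Rescaling.
Variables (w : 'rV[R]_(1 + n.-1) -> R^o) (a a1 a2 : R -> R) (c : R).
Hypotheses (w_C2 : class_C 2 (cone_domain U) w) (c_gt0 : 0 < c).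
Hypotheses
  (a_derive : forall r : R, 0 < r -> is_derive r (1 : R) (a : R -> R^o) (a1 r))
  (a1_derive : forall r : R, 0 < r -> is_derive r (1 : R) (a1 : R -> R^o) (a2 r)).

Let z x := cone_point (c * space_r x) (space_y x).

Let Dz x : cone_domain U x -> cone_domain U (z x).
Proof.
by case=> r0 Uy; split; rewrite /= ?space_r_point ?space_y_point ?mulr_gt0.
Qed.

Let w_derive x i : cone_domain U x ->
  is_derive (z x) (basis_vec i) w (partial i w (z x)).
Proof.
move=> Dx; apply: derivableP; apply: diff_derivable.
by apply: (w_C2.1 [::]) => //; exact: Dz.
Qed.

Let dw_derive x i j : cone_domain U x ->
  is_derive (z x) (basis_vec i) (partial j w) (partial i (partial j w) (z x)).
Proof.
move=> Dx; apply: derivableP; apply: diff_derivable.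
by apply: (w_C2.1 [:: j]) => //; exact: Dz.
Qed.

Variable f : 'rV[R]_(1 + n.-1) -> R^o.
Hypothesis fE : forall x, cone_domain U x -> f x = a (space_r x) * w (z x).

(* G stands for w or one of its partial derivatives, b for a or a1 *)
Let scaled_radial (b : R -> R) db (G : _ -> R^o) dG x :
  is_derive (space_r x) 1 (b : R -> R^o) db ->
  is_derive (z x) (basis_vec radial) G dG ->
  is_derive x (basis_vec radial) (fun x => b (space_r x) * G (z x) : R^o)
    (b (space_r x) * (c * dG) + db * G (z x)).
Proof.
move=> Db DG.
apply: (is_derive_radial (F := fun r y => b r * G (cone_point (c * r) y))).
apply: is_derive_mul Db _; rewrite mulrC.
have := is_derive_radial_comp
  (is_derive_scale c (is_derive_id (space_r x) (1 : R^o))) DG.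
by rewrite mulr1.
Qed.

Let scaled_angular (b : R -> R) A (G : _ -> R^o) dG x :
  is_derive (z x) (basis_vec (angular A)) G dG ->
  is_derive x (basis_vec (angular A)) (fun x => b (space_r x) * G (z x) : R^o)
    (b (space_r x) * dG).
Proof.
move=> DG.
apply: (is_derive_angular (F := fun r y => b r * G (cone_point (c * r) y))).
exact: is_derive_scale (is_derive_slice DG).
Qed.

Let near_cone x (Dx : cone_domain U x) : \forall z \near x, cone_domain U z.
Proof. exact: (open_nbhs_nbhs (conj (open_cone_domain U_open) Dx)). Qed.

Lemma partial_radial_scaled x : cone_domain U x -> partial radial f x =
  a (space_r x) * (c * partial radial w (z x)) + a1 (space_r x) * w (z x).
Proof.
move=> Dx; rewrite /partial.
rewrite (near_eq_derive _ (filterS fE (near_cone Dx))).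
apply: derive_val; apply: scaled_radial (w_derive _ Dx).
by apply: a_derive; case: Dx.
Qed.

Lemma partial_angular_scaled A x : cone_domain U x ->
  partial (angular A) f x = a (space_r x) * partial (angular A) w (z x).
Proof.
move=> Dx; rewrite /partial.
rewrite (near_eq_derive _ (filterS fE (near_cone Dx))).
apply: derive_val; exact: scaled_angular (w_derive _ Dx).
Qed.

Lemma is_derive_rr_scaled x : cone_domain U x ->
  is_derive x (basis_vec radial) (partial radial f)
   (a (space_r x) * (c * (c * partial radial (partial radial w) (z x)))
    + a1 (space_r x) * (c * partial radial w (z x))
    + (a1 (space_r x) * (c * partial radial w (z x)) + a2 (space_r x) * w (z x))).
Proof.
move=> Dx; have r0 : 0 < space_r x by case: Dx.
have E t : cone_domain U t -> a (space_r t) * (c * partial radial w (z t))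
  + a1 (space_r t) * w (z t) = partial radial f t.
  by move=> Dt; rewrite partial_radial_scaled.
apply: (near_eq_is_derive (filterS E (near_cone Dx))).
apply: is_derive_add; last first.
  exact: scaled_radial (a1_derive r0) (w_derive _ Dx).
apply: (scaled_radial (G := fun t => c * partial radial w t)).
  exact: a_derive.
exact: is_derive_scale (dw_derive _ _ Dx).
Qed.

Lemma is_derive_AB_scaled A B x : cone_domain U x ->
  is_derive x (basis_vec (angular A)) (partial (angular B) f)
   (a (space_r x) * partial (angular A) (partial (angular B) w) (z x)).
Proof.
move=> Dx.
have E t : cone_domain U t ->
    a (space_r t) * partial (angular B) w (z t) = partial (angular B) f t.
  by move=> Dt; rewrite partial_angular_scaled.
apply: (near_eq_is_derive (filterS E (near_cone Dx))).
exact: scaled_angular (dw_derive _ _ Dx).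
Qed.

(** The dilation of ratio [c] is a homothety of the cone, hence the factor
    [c ^+ 2]; the other terms come from the radial derivatives that fall on the
    amplitude [a]. *)
Lemma laplacian_scaled x : cone_domain U x ->
  laplacian (cone_metric h) f x =
    a (space_r x) * c ^+ 2 * laplacian (cone_metric h) w (z x)
    + 2 * a1 (space_r x) * c * partial radial w (z x)
    + (a2 (space_r x) + n.-1%:R / space_r x * a1 (space_r x)) * w (z x).
Proof.
move=> Dx; have [r0 _] := Dx; have [Drr vrr] := is_derive_rr_scaled Dx.
rewrite (laplacian_cone Dx Drr) => [|A B]; last first.
  by have [] := is_derive_AB_scaled A B Dx.
have [Dwrr _] := dw_derive radial radial Dx.
rewrite (laplacian_cone (Dz Dx) Dwrr) => [|A B]; last first.
  by have [] := dw_derive (angular A) (angular B) Dx.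
have -> : angular_laplacian f x = a (space_r x) * angular_laplacian w (z x).
  rewrite /angular_laplacian space_y_point mulrBr !mulr_sumr; congr (_ - _).
    apply: eq_bigr => A _; rewrite mulr_sumr; apply: eq_bigr => B _.
    rewrite [partial _ (partial _ f) x]
      (@derive_val _ _ _ _ _ _ _ (is_derive_AB_scaled A B Dx)).
    by rewrite mulrCA.
  by apply: eq_bigr => A _; rewrite partial_angular_scaled// mulrCA.
rewrite [partial _ (partial _ f) x]vrr (partial_radial_scaled Dx) space_r_point.
move: (partial radial (partial radial w) (z x)) (partial radial w (z x)) => p1 p2.
move: (angular_laplacian w (z x)) => p3.
by field; rewrite !gt_eqF.
Qed.

End Rescaling.
End Cone.

(** * The heat equation and its symmetries *)

Section Spacetime.
Context {R : realType} {n : nat}.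
Implicit Types (x : 'rV[R]_(1 + (1 + n.-1))).

Lemma timeD (t : R) x x' : time (t *: x + x') = t * time x + time x'.
Proof. by rewrite /time !mxE. Qed.

Lemma spaceD (t : R) x x' : space (t *: x + x') = t *: space x + space x'.
Proof. by apply/rowP => k; rewrite !mxE. Qed.

Lemma time_basis_t : time (basis_vec (@idx_t n)) = 1 :> R.
Proof. by rewrite /time !mxE !eqxx. Qed.

Lemma space_basis_t : space (basis_vec (@idx_t n)) = 0 :> 'rV[R]_(1 + n.-1).
Proof. by apply/rowP => k; rewrite !mxE eq_rlshift. Qed.

Lemma time_basis_space (i : 'I_(1 + n.-1)) : time (basis_vec (rshift 1 i)) = 0 :> R.
Proof. by rewrite basis_rshift /time row_mxKl mxE. Qed.

Lemma space_basis_space (i : 'I_(1 + n.-1)) :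
  space (basis_vec (rshift 1 i)) = basis_vec i :> 'rV[R]_(1 + n.-1).
Proof. by rewrite basis_rshift /space row_mxKr. Qed.

Lemma sum_spacetime (F : 'I_(1 + (1 + n.-1)) -> R) :
  \sum_i F i = F idx_t + (F idx_r + \sum_A F (idx_y A)).
Proof. by rewrite big_split_ord big_ord1 sum_cone. Qed.

Variables (U : set 'rV[R]_n.-1) (h : 'rV[R]_n.-1 -> 'M[R]_n.-1).
Hypotheses (n_gt0 : (0 < n)%N).
Hypotheses (U_open : open U) (h_metric : pseudo_metric_on U h).

(** The heat operator acts on the slices t = constant; their partial derivatives
    are the spatial ones of [u]. *)
Lemma heat_operatorE u x :
  class_C 2 (spacetime_domain U) u -> spacetime_domain U x ->
  heat_operator (cone_metric h) u x = heat_jet h (jet2_of u x).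
Proof.
move=> u_C2 Dx.
have xE : row_mx (lsubmx x) (space x) = x by exact: hsubmxK.
have slice1 i : partial i (fun s => u (row_mx (lsubmx x) s)) (space x) =
    partial (rshift 1 i) u x by rewrite partial_slice xE.
have slice2 i j :
    partial i (partial j (fun s => u (row_mx (lsubmx x) s))) (space x) =
    partial (rshift 1 i) (partial (rshift 1 j) u) x.
  by rewrite !partial_slice xE.
have slice_derivable i j : derivable
    (partial j (fun s => u (row_mx (lsubmx x) s))) (space x) (basis_vec i).
  rewrite partial_slice.
  have : derivable (partial (rshift 1 j) u) x (basis_vec (rshift 1 i)).
    by apply: diff_derivable; apply: (u_C2.1 [:: _]).
  by move=> /derivableP; rewrite -{1}xE => /is_derive_slice [].
rewrite /heat_operator (laplacian_cone U_open h_metric) // natr_pred //.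
rewrite /heat_jet /= !mxE slice1 slice2 /angular_laplacian.
have -> : \sum_A \sum_B invmx (h (space_y (space x))) A B * partial (angular A)
    (partial (angular B) (fun s => u (row_mx (lsubmx x) s))) (space x) =
  \sum_A \sum_B invmx (h (space_y (space x))) A B *
    (\matrix_(i, k) partial k (partial i u) x) (idx_y A) (idx_y B).
  (* the jet has its indices in the other order; h^AB is symmetric *)
  rewrite exchange_big; apply: eq_bigr => A _; apply: eq_bigr => B _ /=.
  by rewrite mxE slice2 (invmx_metric_sym h_metric) //; case: Dx.
have -> : \sum_A contracted_christoffel h A (space_y (space x)) *
    partial (angular A) (fun s => u (row_mx (lsubmx x) s)) (space x) =
  \sum_A contracted_christoffel h A (space_y (space x)) *
    (\row_i partial i u x) 0 (idx_y A).
  by apply: eq_bigr => A _; rewrite mxE slice1.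
rewrite mulrBr; ring.
Qed.

End Spacetime.

Section HeatSymmetries.
Context {R : realType} {n : nat}.
Variables (al be : R).

(** The field al X2 + be X1. Its time component has derivative 2 (al t + be),
    twice the dilation rate of the radius, as parabolic scaling requires. *)
Definition heat_field (e : jet0 R (1 + (1 + n.-1))) : jet0 R (1 + (1 + n.-1)) :=
  (row_mx (al * time e.1 ^+ 2 + be * (2 * time e.1))%:M
     ((al * time e.1 + be) *: radial_field (space e.1)),
   - (al * (4^-1 * space_r (space e.1) ^+ 2 + n%:R / 2 * time e.1)) * e.2).

Implicit Types (e : jet0 R (1 + (1 + n.-1))).
Implicit Types (j : jet1 R (1 + (1 + n.-1))) (J : jet2 R (1 + (1 + n.-1))).

Local Notation rad e := (space_r (space e)).
(* [bt i] and [br i] are the Kronecker symbols of i with t and r: one formula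
   then covers all the components of the prolongations *)
Local Notation bt i := (time (basis_vec i : 'rV[R]_(1 + (1 + n.-1)))).
Local Notation br i := (space_r (space (basis_vec i : 'rV[R]_(1 + (1 + n.-1))))).
Local Notation rate e := (al * time e + be).
Local Notation damping e :=
  (al * (4^-1 * space_r (space e) ^+ 2 + n%:R / 2 * time e)).

Lemma time_heat_field e :
  time (heat_field e).1 = al * time e.1 ^+ 2 + be * (2 * time e.1).
Proof. by rewrite /time row_mxKl mxE mulr1n. Qed.

Lemma radius_heat_field e : space_r (space (heat_field e).1) =
  (al * time e.1 + be) * space_r (space e.1).
Proof.
by rewrite /space row_mxKr /space_r [LHS]mxE mxE row_mxEl mxE mulr1n.
Qed.

Lemma angles_heat_field e : space_y (space (heat_field e).1) = 0.
Proof.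
rewrite /space row_mxKr /space_y [rsubmx (_ *: _)]linearZ /= row_mxKr.
by rewrite scaler0.
Qed.

Lemma is_derive_heat_time e : is_derive e (heat_field e)
  (fun e => time e.1 : R^o) (al * time e.1 ^+ 2 + be * (2 * time e.1)).
Proof. by apply: is_derive_affine => t; rewrite /= timeD time_heat_field. Qed.

Lemma is_derive_heat_radius e : is_derive e (heat_field e)
  (fun e => space_r (space e.1) : R^o)
  ((al * time e.1 + be) * space_r (space e.1)).
Proof.
by apply: is_derive_affine => t; rewrite /= spaceD space_rD radius_heat_field.
Qed.

Lemma total_derive0_time i j :
  total_derive0 i (fun e => (heat_field e).1 0 idx_t) j =
  2 * rate j.1.1 * bt i.
Proof.
rewrite /total_derive0.
pose v : jet0 R (1 + (1 + n.-1)) := (basis_vec i, j.2 0 i).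
have Dt : is_derive j.1 v (fun e : jet0 R (1 + (1 + n.-1)) => time e.1 : R^o) (bt i).
  by apply: is_derive_affine => t /=; rewrite timeD.
under eq_fun do rewrite row_mxEl mxE mulr1n.
apply: derive_val; differentiate; ring.
Qed.

Lemma total_derive0_radial i j :
  total_derive0 i (fun e => (heat_field e).1 0 idx_r) j =
  al * bt i * rad j.1.1 + rate j.1.1 * br i.
Proof.
rewrite /total_derive0.
pose v : jet0 R (1 + (1 + n.-1)) := (basis_vec i, j.2 0 i).
have Dt : is_derive j.1 v (fun e : jet0 R (1 + (1 + n.-1)) => time e.1 : R^o) (bt i).
  by apply: is_derive_affine => t /=; rewrite timeD.
have Dr : is_derive j.1 v (fun e : jet0 R (1 + (1 + n.-1)) =>
    space_r (space e.1) : R^o) (br i).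
  by apply: is_derive_affine => t /=; rewrite spaceD space_rD.
under eq_fun do rewrite row_mxEr mxE row_mxEl mxE mulr1n.
apply: derive_val; differentiate; ring.
Qed.

Lemma total_derive0_angular i A j :
  total_derive0 i (fun e => (heat_field e).1 0 (idx_y A)) j = 0.
Proof.
rewrite /total_derive0.
under eq_fun do rewrite row_mxEr mxE row_mxEr mxE mulr0.
exact: derive_cst.
Qed.

Lemma total_derive0_unknown i j :
  total_derive0 i (fun e => (heat_field e).2) j =
  - (al * (2^-1 * rad j.1.1 * br i + n%:R / 2 * bt i)) * j.1.2
  - damping j.1.1 * j.2 0 i.
Proof.
rewrite /total_derive0.
pose v : jet0 R (1 + (1 + n.-1)) := (basis_vec i, j.2 0 i).
have Dt : is_derive j.1 v (fun e : jet0 R (1 + (1 + n.-1)) => time e.1 : R^o) (bt i).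
  by apply: is_derive_affine => t /=; rewrite timeD.
have Dr : is_derive j.1 v (fun e : jet0 R (1 + (1 + n.-1)) =>
    space_r (space e.1) : R^o) (br i).
  by apply: is_derive_affine => t /=; rewrite spaceD space_rD.
have Du : is_derive j.1 v (fun e : jet0 R (1 + (1 + n.-1)) => e.2) (j.2 0 i).
  by apply: is_derive_affine.
apply: derive_val; differentiate; by field.
Qed.

Lemma prolong1E i : prolong1 heat_field i = fun j =>
  - (al * (2^-1 * rad j.1.1 * br i + n%:R / 2 * bt i)) * j.1.2
  - damping j.1.1 * j.2 0 i
  - (2 * rate j.1.1 * bt i * j.2 0 idx_t
     + (al * bt i * rad j.1.1 + rate j.1.1 * br i) * j.2 0 idx_r).
Proof.
apply/funext => j; rewrite /prolong1 total_derive0_unknown sum_spacetime.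
rewrite total_derive0_time total_derive0_radial big1 => [|A _].
  by rewrite addr0 [X in _ - (X + _)]mulrC [X in _ - (_ + X)]mulrC.
by rewrite total_derive0_angular mulr0.
Qed.

Lemma prolong2E i k J : prolong2 heat_field i k J =
  - (al * (2^-1 * br k * br i)) * J.1.1.2
  - al * (2^-1 * rad J.1.1.1 * br i + n%:R / 2 * bt i) * J.1.2 0 k
  - al * (2^-1 * rad J.1.1.1 * br k + n%:R / 2 * bt k) * J.1.2 0 i
  - damping J.1.1.1 * J.2 k i
  - 2 * al * bt k * bt i * J.1.2 0 idx_t
  - 2 * rate J.1.1.1 * (bt i * J.2 k idx_t + bt k * J.2 i idx_t)
  - al * (bt i * br k + bt k * br i) * J.1.2 0 idx_r
  - (al * bt i * rad J.1.1.1 + rate J.1.1.1 * br i) * J.2 k idx_r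
  - (al * bt k * rad J.1.1.1 + rate J.1.1.1 * br k) * J.2 i idx_r.
Proof.
rewrite /prolong2 sum_spacetime total_derive0_time total_derive0_radial.
rewrite big1 => [|A _]; last by rewrite total_derive0_angular mulr0.
rewrite /total_derive1 prolong1E.
pose v : jet1 R (1 + (1 + n.-1)) := (basis_vec k, J.1.2 0 k, row k J.2).
have Dt : is_derive J.1 v (fun e : jet1 R (1 + (1 + n.-1)) => time e.1.1 : R^o) (bt k).
  by apply: is_derive_affine => t /=; rewrite timeD.
have Dr : is_derive J.1 v (fun e : jet1 R (1 + (1 + n.-1)) =>
    space_r (space e.1.1) : R^o) (br k).
  by apply: is_derive_affine => t /=; rewrite spaceD space_rD.
have Du : is_derive J.1 v (fun e : jet1 R (1 + (1 + n.-1)) => e.1.2) (J.1.2 0 k).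
  by apply: is_derive_affine.
have Du1 l : is_derive J.1 v (fun e : jet1 R (1 + (1 + n.-1)) => e.2 0 l : R^o)
    (J.2 k l).
  by apply: is_derive_affine => t /=; rewrite !mxE.
apply/(canLR (subrK _))/derive_val; differentiate; by field.
Qed.

End HeatSymmetries.

Section SymmetryCondition.
Context {R : realType} {n : nat}.
Variables (al be : R) (h : 'rV[R]_n.-1 -> 'M[R]_n.-1) (U : set 'rV[R]_n.-1).

(** Along the prolongation the heat expression is multiplied by
    - (C + 2 (al t + be)), with C the coefficient of - u d_u, up to a multiple of
    al u whose coefficient is - 1/2 - (n - 1) / 2 + n / 2 = 0. *)
Lemma heat_field_symmetry :
  lie_point_symmetry (spacetime_domain U) (heat_jet h) (heat_field al be).
Proof.
move=> J [r_gt0 _] J_sym FJ.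
set v := prolongation _ J.
pose y := space_y (space J.1.1.1).
pose Q (j : jet2 R (1 + (1 + n.-1))) : R^o := \sum_A \sum_B
  invmx (h (space_y (space j.1.1.1))) A B * j.2 (idx_y A) (idx_y B).
pose L (j : jet2 R (1 + (1 + n.-1))) : R^o := \sum_A
  contracted_christoffel h A (space_y (space j.1.1.1)) * j.1.2 0 (idx_y A).
set C := al * (4^-1 * space_r (space J.1.1.1) ^+ 2
  + n%:R / 2 * time J.1.1.1).
have J_symE k l : J.2 k l = J.2 l k by rewrite -{1}J_sym mxE.
(* the angles do not move, so that h is constant along the line *)
have v_y : space_y (space v.1.1.1) = 0 by exact: angles_heat_field.
have Dr : is_derive J v
    (fun j : jet2 R (1 + (1 + n.-1)) => space_r (space j.1.1.1) : R^o)
    ((al * time J.1.1.1 + be) * space_r (space J.1.1.1)).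
  apply: is_derive_affine => t /=.
  by rewrite spaceD space_rD -(radius_heat_field al be J.1.1).
have y_const t : space_y (space (t *: v + J).1.1.1) = y.
  by rewrite /= spaceD space_yD v_y scaler0 add0r.
have DQ : is_derive J v Q (- C * Q J).
  apply: is_derive_affine => t; rewrite /Q y_const !mulr_sumr -big_split.
  apply: eq_bigr => A _; rewrite !mulr_sumr -big_split; apply: eq_bigr => B _.
  rewrite /= !mxE prolong2E !time_basis_space !space_basis_space.
  rewrite !space_r_angular -/y -/C [J.2 (idx_y B) _]J_symE; ring.
have DL : is_derive J v L (- C * L J).
  apply: is_derive_affine => t; rewrite /L y_const !mulr_sumr -big_split.
  apply: eq_bigr => A _.
  rewrite /= !mxE prolong1E !time_basis_space !space_basis_space.
  rewrite !space_r_angular -/y -/C; ring.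
have Dut : is_derive J v (fun j : jet2 R (1 + (1 + n.-1)) => j.1.2 0 idx_t : R^o)
    (prolong1 (heat_field al be) idx_t J.1).
  by apply: is_derive_affine => t /=; rewrite !mxE.
have Dur : is_derive J v (fun j : jet2 R (1 + (1 + n.-1)) => j.1.2 0 idx_r : R^o)
    (prolong1 (heat_field al be) idx_r J.1).
  by apply: is_derive_affine => t /=; rewrite !mxE.
have Durr : is_derive J v
    (fun j : jet2 R (1 + (1 + n.-1)) => j.2 idx_r idx_r : R^o)
    (prolong2 (heat_field al be) idx_r idx_r J).
  by apply: is_derive_affine => t /=; rewrite !mxE.
have r0 : space_r (space J.1.1.1) != 0 by rewrite gt_eqF.
have Dr2 := is_derive_inv (f := fun j : jet2 R (1 + (1 + n.-1)) =>
  space_r (space j.1.1.1) ^+ 2 : R^o) (expf_neq0 2 r0) (is_derive_pow 2 Dr).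
have Dr1 := is_derive_inv (f := fun j : jet2 R (1 + (1 + n.-1)) =>
  space_r (space j.1.1.1) : R^o) r0 Dr.
(* on the equation, u_t is a function of the other jet coordinates *)
have F_eq : J.1.2 0 idx_t = J.2 idx_r idx_r + (space_r (space J.1.1.1) ^+ 2)^-1 * Q J
  + (n%:R - 1) / space_r (space J.1.1.1) * J.1.2 0 idx_r
  - (space_r (space J.1.1.1) ^+ 2)^-1 * L J.
  by apply/eqP; rewrite eq_sym -subr_eq0; apply/eqP.
change (is_derive J v (fun j => j.2 idx_r idx_r
  + (space_r (space j.1.1.1) ^+ 2)^-1 * Q j
  + (n%:R - 1) / space_r (space j.1.1.1) * j.1.2 0 idx_r
  - (space_r (space j.1.1.1) ^+ 2)^-1 * L j - j.1.2 0 idx_t : R^o) 0).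
differentiate.
rewrite prolong2E !prolong1E /idx_r !time_basis_space !space_basis_space.
rewrite -[lshift _ ord0]/radial space_r_radial time_basis_t space_basis_t.
rewrite -[rshift 1 radial]/(@idx_r n) F_eq.
have -> : space_r (0 : 'rV[R]_(1 + n.-1)) = 0 by rewrite /space_r !mxE.
move: (Q J) (L J) (J.2 idx_r idx_r) (J.1.2 0 idx_r) => q l u_rr u_r.
rewrite /C; by field.
Qed.

End SymmetryCondition.

Lemma X1_heat_field (R : realType) n :
  @X1 R n = heat_field 0 1.
Proof.
apply/funext => e; rewrite /X1 /heat_field !mul0r oppr0 mul0r !add0r.
by rewrite mul1r scale1r.
Qed.

Lemma X2_heat_field (R : realType) n :
  @X2 R n = heat_field 1 0.
Proof.
by apply/funext => e; rewrite /X2 /heat_field !mul1r mul0r !addr0.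
Qed.

(** * The gradient homothetic vector field *)

Section RadialField.
Context {R : realType} {n : nat}.
Variables (D : set 'rV[R]_(1 + n.-1)) (h : 'rV[R]_n.-1 -> 'M[R]_n.-1).
Implicit Types (x : 'rV[R]_(1 + n.-1)).

Lemma radial_fieldE x l : radial_field x 0 l = (l == radial)%:R * space_r x.
Proof.
case: (split_ordP l) => [k ->|A ->].
  by rewrite [k]ord1 row_mxEl mxE eqxx mulr1n mul1r.
by rewrite row_mxEr mxE eq_rlshift mul0r.
Qed.

Lemma space_r_basis l :
  space_r (basis_vec l : 'rV[R]_(1 + n.-1)) = (l == radial)%:R.
Proof.
case: (split_ordP l) => [k ->|A ->]; first by rewrite [k]ord1 space_r_radial eqxx.
by rewrite space_r_angular eq_rlshift.
Qed.

Lemma partial_radial_field k l x :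
  partial k (fun z => radial_field z 0 l) x = (l == radial)%:R * (k == radial)%:R.
Proof.
rewrite /partial; under eq_fun do rewrite radial_fieldE.
apply: derive_val; rewrite -(space_r_basis k).
exact: is_derive_scale (is_derive_space_r _ _).
Qed.

Lemma cone_metric_radial x l : cone_metric h x radial l = (l == radial)%:R.
Proof.
case: (split_ordP l) => [k ->|A ->].
  by rewrite [k]ord1 block_mxEul mxE !eqxx.
by rewrite block_mxEur mxE eq_rlshift.
Qed.

Lemma cone_metric_radialr x l : cone_metric h x l radial = (l == radial)%:R.
Proof.
case: (split_ordP l) => [k ->|A ->].
  by rewrite [k]ord1 block_mxEul mxE !eqxx.
by rewrite block_mxEdl mxE eq_rlshift.
Qed.

Lemma radial_field_homothetic : homothetic_vector D (cone_metric h) radial_field.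
Proof.
move=> x _ i j; rewrite /lie_derivative_metric.
under eq_bigr do rewrite !partial_radial_field radial_fieldE.
rewrite sum_cone big1 => [|A _]; last by rewrite eq_rlshift !mul0r !mulr0 !addr0.
rewrite addr0 eqxx !mul1r cone_metric_radial cone_metric_radialr.
case: (split_ordP i) => [k ->|A ->]; last case: (split_ordP j) => [k ->|B ->].
- rewrite [k]ord1 -[lshift _ _]/radial eqxx.
  under eq_fun do rewrite cone_metric_radial.
  by rewrite cone_metric_radial /partial derive_cst mulr0 add0r !mul1r mulr1 -mulr2n mulr_natl.
- rewrite [k]ord1 -[lshift _ _]/radial eq_rlshift.
  under eq_fun do rewrite cone_metric_radialr.
  by rewrite cone_metric_radialr /partial derive_cst eq_rlshift !mulr0 mul0r !addr0.
- rewrite !eq_rlshift !mulr0 !addr0 block_mxEdr mxE.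
  have -> : partial radial (fun z => cone_metric h z (rshift 1 A) (rshift 1 B)) x =
      2 * space_r x * h (space_y x) A B.
    rewrite /partial; under eq_fun do rewrite block_mxEdr mxE.
    apply: derive_val.
    apply: (is_derive_radial (F := fun r y => r ^+ 2 * h y A B)).
    have Dr := is_derive_id (space_r x) (1 : R^o).
    differentiate; ring.
  by ring.
Qed.

Lemma radial_field_gradient : gradient_vector D (cone_metric h) radial_field.
Proof.
exists (fun x => 2^-1 * space_r x ^+ 2) => x _ i.
under eq_bigr do rewrite radial_fieldE.
rewrite sum_cone big1 => [|A _]; last by rewrite eq_rlshift mul0r mulr0.
rewrite addr0 eqxx mul1r cone_metric_radialr -space_r_basis.
have Dr := is_derive_space_r x (basis_vec i).
by differentiate; field.
Qed.

End RadialField.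

(** * Reduction of the heat equation *)

Section HeatReduction.
Context {R : realType} {n : nat}.
Variables (U : set 'rV[R]_n.-1) (h : 'rV[R]_n.-1 -> 'M[R]_n.-1).
Hypotheses (n_gt2 : (2 < n)%N).
Hypotheses (U_open : open U) (h_metric : pseudo_metric_on U h).
Implicit Types (x : 'rV[R]_(1 + (1 + n.-1))).

Lemma open_future_domain : open (future_domain U).
Proof. exact: open_pos_first (open_cone_domain U_open). Qed.

Lemma is_derive_time (F : R -> 'rV[R]_(1 + n.-1) -> R^o) x d :
  is_derive (time x) 1 (F ^~ (space x) : R -> R^o) d ->
  is_derive x (basis_vec (@idx_t n)) (fun z => F (time z) (space z) : R^o) d.
Proof.
move=> /is_derive_line D; apply/is_derive_line.
under eq_fun do
  rewrite timeD spaceD time_basis_t space_basis_t scaler0 add0r.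
exact: D.
Qed.

(** Functions of the form u = a(t, r) w(c(t) r, y). *)
Section SimilaritySolution.
Variables (a a1 a2 a_t : R -> R -> R) (c dc : R -> R).
Variables (w : 'rV[R]_(1 + n.-1) -> R^o) (u : 'rV[R]_(1 + (1 + n.-1)) -> R^o).
Hypotheses (w_C2 : class_C 2 (cone_domain U) w)
  (c_gt0 : forall t, 0 < t -> 0 < c t)
  (c_derive : forall t : R, 0 < t -> is_derive t (1 : R) (c : R -> R^o) (dc t))
  (a_derive : forall t r : R, 0 < t -> 0 < r ->
     is_derive r (1 : R) (a t : R -> R^o) (a1 t r))
  (a1_derive : forall t r : R, 0 < t -> 0 < r ->
     is_derive r (1 : R) (a1 t : R -> R^o) (a2 t r))
  (a_t_derive : forall t r : R, 0 < t -> 0 < r ->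
     is_derive t (1 : R) (a ^~ r : R -> R^o) (a_t t r)).

Let z x := cone_point (c (time x) * space_r (space x)) (space_y (space x)).

Hypothesis uE : forall x, future_domain U x ->
  u x = a (time x) (space_r (space x)) * w (z x).

(** The drift has two sources: the mixed term of the radial Laplacian of the
    product a w, and the time derivative of the argument c(t) r of w. *)
Lemma heat_operator_similarity x : future_domain U x ->
  let t := time x in let r := space_r (space x) in
  heat_operator (cone_metric h) u x =
    a t r * c t ^+ 2 * laplacian (cone_metric h) w (z x)
    + (2 * a1 t r * c t - a t r * r * dc t) * partial radial w (z x)
    + (a2 t r + n.-1%:R / r * a1 t r - a_t t r) * w (z x).
Proof.
move=> Dx t r; have [t_gt0 Ds] := Dx; have [r_gt0 Uy] := Ds.
have Dz : cone_domain U (z x).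
  by split; rewrite /= ?space_r_point ?space_y_point ?mulr_gt0 ?c_gt0.
pose f (s : 'rV[R]_(1 + n.-1)) : R^o := u (row_mx (lsubmx x) s).
have fE s : cone_domain U s ->
    f s = a t (space_r s) * w (cone_point (c t * space_r s) (space_y s)).
  move=> D's; rewrite /f uE /z /time /space ?row_mxKl ?row_mxKr//.
  by split; rewrite /= /time /space ?row_mxKl ?row_mxKr.
have -> : heat_operator (cone_metric h) u x =
  laplacian (cone_metric h) f (space x) - partial idx_t u x by [].
rewrite (laplacian_scaled U_open h_metric w_C2 (c_gt0 t_gt0)
  (fun r => @a_derive t r t_gt0) (fun r => @a1_derive t r t_gt0) fE Ds).
have -> : partial idx_t u x =
    a t r * (partial radial w (z x) * (r * dc t)) + a_t t r * w (z x).
  rewrite /partial.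
  have near_D : \forall x' \near x, future_domain U x'.
    exact: (open_nbhs_nbhs (conj open_future_domain Dx)).
  rewrite (near_eq_derive _ (filterS uE near_D)).
  apply: derive_val.
  apply: (is_derive_time (F := fun t s => a t (space_r s) *
    w (cone_point (c t * space_r s) (space_y s)))).
  apply: is_derive_mul; first exact: a_t_derive.
  have Dw : is_derive (z x) (basis_vec radial) w (partial radial w (z x)).
    by apply: derivableP; apply: diff_derivable; exact: (w_C2.1 [::]).
  apply: (is_derive_radial_comp (s := fun t => c t * r)) Dw.
  have Dc := c_derive t_gt0.
  have := is_derive_scale r Dc.
  by under eq_fun do rewrite mulrC.
rewrite -/(z x) -/r.
move: (laplacian _ w _) (partial radial w (z x)) (w (z x)) => p0 p1 p2.
by rewrite /z; ring.
Qed.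

End SimilaritySolution.

(** The reduced equation holds at all points because the invariants take all
    values. *)
Lemma reduced_equation_equiv (p q : nat) (D : set 'rV[R]_p) (D' : set 'rV[R]_q)
    (z : 'rV[R]_p -> 'rV[R]_q) (mu E : 'rV[R]_p -> R) (E' : 'rV[R]_q -> R) :
  z @` D = D' -> (forall v, D v -> mu v != 0) ->
  (forall v, D v -> E v = mu v * E' (z v)) ->
  (forall v, D v -> E v = 0) <-> (forall y, D' y -> E' y = 0).
Proof.
move=> <- mu0 EE; split=> [E0 _ [x Dx <-]|E'0 x Dx].
  apply: (mulfI (mu0 x Dx)); rewrite mulr0 -EE//; exact: E0.
by rewrite EE// E'0 ?mulr0//; exists x.
Qed.

Lemma new_coords1_image : new_coords1 @` future_domain U = cone_domain U.
Proof.
apply/seteqP; split=> [_ [x [t0 [r0 Uy]] <-]|s Ds].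
  split; rewrite /= /new_coords1 -/(cone_point _ _) ?space_y_point//.
  by rewrite space_r_point divr_gt0 ?sqrtr_gt0.
(* the slice t = 1 is enough *)
exists (row_mx 1%:M s).
  split; rewrite /= /space /time ?row_mxKl ?row_mxKr//.
  by rewrite mxE eqxx ltr01.
rewrite /new_coords1 /time /space !row_mxKr row_mxKl mxE eqxx sqrtr1 divr1.
exact: cone_pointK.
Qed.

Lemma new_coords2_image : new_coords2 @` future_domain U = cone_domain U.
Proof.
apply/seteqP; split=> [_ [x [t0 [r0 Uy]] <-]|s Ds].
  split; rewrite /= /new_coords2 -/(cone_point _ _) ?space_y_point//.
  by rewrite space_r_point divr_gt0.
(* the slice t = 1 is enough *)
exists (row_mx 1%:M s).
  split; rewrite /= /space /time ?row_mxKl ?row_mxKr//.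
  by rewrite mxE eqxx ltr01.
rewrite /new_coords2 /time /space !row_mxKr row_mxKl mxE eqxx divr1.
exact: cone_pointK.
Qed.

(** Here a = 1 and c = t^(-1/2): the drift - r c' w_phi is phi / (2 t) w_phi, and
    1/t is the common factor of the drift and of the Laplacian. *)
Lemma reduces_by_X1 : reduces_by X1 (future_domain U)
  (heat_operator (cone_metric h)) new_coords1 new_unknown1
  (cone_domain U) (laplacian (conformal_cone_metric h)).
Proof.
split.
- rewrite X1_heat_field => k e [t_gt0 _].
  case: (split_ordP k) => [i ->|A ->]; last first.
    apply: is_derive_constant => t.
    by rewrite /new_coords1 !row_mxEr /= spaceD space_yD angles_heat_field
      scaler0 add0r.
  have Dt := is_derive_heat_time 0 1 e.
  have Dr := is_derive_heat_radius 0 1 e.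
  have s_gt0 : 0 < Num.sqrt (time e.1) by rewrite sqrtr_gt0.
  have Ds := is_derive_comp_real (f := fun e : jet0 R _ => time e.1 : R^o)
    (is_derive1_sqrt t_gt0) Dt.
  have Dsv := is_derive_inv (f := fun e : jet0 R _ => Num.sqrt (time e.1) : R^o)
    (lt0r_neq0 s_gt0) Ds.
  rewrite [i]ord1 /new_coords1; under eq_fun do rewrite row_mxEl mxE mulr1n.
  differentiate.
  move: s_gt0 (sqr_sqrtr (ltW t_gt0)).
  move: (time e.1) (Num.sqrt (time e.1)) => t s s_gt0 <-.
  by field; rewrite gt_eqF.
- by move=> e _; apply: is_derive_constant => t; rewrite /new_unknown1 /= scaler0 add0r.
- exact: new_coords1_image.
- by move=> x _; exists id.
pose phi x := space_r (space x) / Num.sqrt (time x).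
exists (fun x => (time x)^-1 * expR (phi x ^+ 2 / (2 * (n%:R - 2)))).
have mu0 x : future_domain U x ->
    (time x)^-1 * expR (phi x ^+ 2 / (2 * (n%:R - 2))) != 0.
  by move=> [t0 _]; rewrite mulf_neq0 ?invr_eq0 ?gt_eqF ?expR_gt0.
split=> // u w w_C2 uw.
suff E x : future_domain U x -> heat_operator (cone_metric h) u x =
    (time x)^-1 * expR (phi x ^+ 2 / (2 * (n%:R - 2))) *
    laplacian (conformal_cone_metric h) w (new_coords1 x).
  split=> //; exact: reduced_equation_equiv new_coords1_image mu0 E.
move=> Dx; have [t_gt0 [r_gt0 Uy]] := Dx.
have s_gt0 : 0 < Num.sqrt (time x) by rewrite sqrtr_gt0.
have zE : new_coords1 x =
    cone_point ((Num.sqrt (time x))^-1 * space_r (space x)) (space_y (space x)).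
  by rewrite mulrC.
have Dz : cone_domain U (new_coords1 x).
  by rewrite -new_coords1_image; exists x.
have c_gt0 (t : R) : 0 < t -> 0 < (Num.sqrt t)^-1.
  by move=> t0; rewrite invr_gt0 sqrtr_gt0.
have c_derive (t : R) : 0 < t -> is_derive t (1 : R)
    (fun t => (Num.sqrt t)^-1 : R^o) (- (Num.sqrt t) ^- 2 * (2 * Num.sqrt t)^-1).
  move=> t0; apply: (is_derive_inv (f := Num.sqrt)); last exact: is_derive1_sqrt.
  by rewrite gt_eqF ?sqrtr_gt0.
have cst_derive (k t r : R) : 0 < t -> 0 < r ->
    is_derive r (1 : R) (fun _ : R => k : R^o) 0.
  by move=> _ _; exact: is_derive_cst.
have cst_t_derive (k t r : R) : 0 < t -> 0 < r ->
    is_derive t (1 : R) (fun _ : R => k : R^o) 0.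
  by move=> _ _; exact: is_derive_cst.
have uE x' : future_domain U x' -> u x' = 1 * w (cone_point
    ((Num.sqrt (time x'))^-1 * space_r (space x')) (space_y (space x'))).
  by move=> Dx'; rewrite mul1r -[u x']/(new_unknown1 (x', u x')) -uw// mulrC.
rewrite (heat_operator_similarity (a := fun _ _ => 1) w_C2 c_gt0 c_derive
  (cst_derive 1) (cst_derive 0) (cst_t_derive 1) uE Dx).
have dw_derivable i j : derivable (partial j w) (new_coords1 x) (basis_vec i).
  by apply: diff_derivable; exact: (w_C2.1 [:: _]).
rewrite -zE (laplacian_conformal_cone U_open h_metric n_gt2 Dz
  (@dw_derivable _ _) (fun A B => @dw_derivable _ _)).
have -> : space_r (new_coords1 x) = phi x by exact: space_r_point.
have e0 := expR_gt0 (phi x ^+ 2 / (2 * (n%:R - 2))).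
rewrite -[(time x)^-1 * _ * _]mulrA mulVKf ?gt_eqF//.
move: (laplacian _ w _) (partial radial w _) (w _) => p0 p1 p2.
rewrite /phi; move: s_gt0 (sqr_sqrtr (ltW t_gt0)).
move: (time x) (Num.sqrt (time x)) => t s s_gt0 <-.
by field; rewrite !gt_eqF.
Qed.

Lemma is_derive_powR (k t : R) : 0 < t ->
  is_derive t (1 : R) (fun s => s `^ k : R^o) (k * (t `^ k / t)).
Proof.
move=> t0; apply: (is_derive_eq (is_derive1_powR k t0)).
congr (_ * _); apply: (mulIf (lt0r_neq0 t0)); rewrite divfK ?gt_eqF//.
rewrite -{2}(powRr1 (ltW t0)) -powRD ?subrK//.
by rewrite (gt_eqF t0) implybT.
Qed.

(** Here c = 1/t, and a is up to a constant the heat kernel of the flat space of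
    dimension n, centred at the tip: it satisfies the radial heat equation
    a_t = a_rr + (n - 1) / r a_r, and a_r = - r / (2 t) a makes 2 a_r c and a r c'
    equal. *)
Lemma reduces_by_X2 : reduces_by X2 (future_domain U)
  (heat_operator (cone_metric h)) new_coords2 new_unknown2
  (cone_domain U) (laplacian (cone_metric h)).
Proof.
split.
- rewrite X2_heat_field => k e [t_gt0 _].
  case: (split_ordP k) => [i ->|A ->]; last first.
    apply: is_derive_constant => t.
    by rewrite /new_coords2 !row_mxEr /= spaceD space_yD angles_heat_field
      scaler0 add0r.
  have Dt := is_derive_heat_time 1 0 e.
  have Dr := is_derive_heat_radius 1 0 e.
  have Dtv := is_derive_inv (f := fun e : jet0 R _ => time e.1 : R^o)
    (lt0r_neq0 t_gt0) Dt.
  rewrite [i]ord1 /new_coords2; under eq_fun do rewrite row_mxEl mxE mulr1n.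
  by differentiate; field; rewrite gt_eqF.
- rewrite X2_heat_field => e [t_gt0 _].
  have Dt := is_derive_heat_time 1 0 e.
  have Dr := is_derive_heat_radius 1 0 e.
  have Du : is_derive e (heat_field 1 0 e) (fun e : jet0 R _ => e.2)
    (heat_field 1 0 e).2 by exact: is_derive_affine.
  have Dp := is_derive_comp_real (f := fun e : jet0 R _ => time e.1 : R^o)
    (is_derive_powR (n%:R / 2) t_gt0) Dt.
  have t4_neq0 : 4 * time e.1 != 0 by rewrite mulf_neq0 ?gt_eqF.
  have Dt4v := is_derive_inv (f := fun e : jet0 R _ => 4 * time e.1 : R^o)
    t4_neq0 (is_derive_scale 4 Dt).
  have De := is_derive_comp_real
    (f := fun e : jet0 R _ => space_r (space e.1) ^+ 2 / (4 * time e.1) : R^o)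
    (is_derive_expR _) (is_derive_mul (is_derive_pow 2 Dr) Dt4v).
  rewrite /new_unknown2.
  differentiate.
  move: (_ `^ _) (expR _) => p q.
  by field; rewrite gt_eqF.
- exact: new_coords2_image.
- move=> x [t_gt0 _].
  have k_neq0 : time x `^ (n%:R / 2) *
      expR (space_r (space x) ^+ 2 / (4 * time x)) != 0.
    by rewrite mulf_neq0 ?gt_eqF ?powR_gt0 ?expR_gt0.
  exists (fun v : R => v / (time x `^ (n%:R / 2) *
      expR (space_r (space x) ^+ 2 / (4 * time x)))) => v.
    by rewrite /new_unknown2 /= -mulrA mulfK.
  by rewrite /new_unknown2 /= -mulrA divfK.
pose a (t r : R) : R := (t `^ (n%:R / 2))^-1 * expR (- (r ^+ 2 / (4 * t))).
have a_gt0 t r : 0 < t -> 0 < a t r.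
  by move=> t0; rewrite mulr_gt0 ?invr_gt0 ?powR_gt0 ?expR_gt0.
exists (fun x => a (time x) (space_r (space x)) / time x ^+ 2).
have mu0 x : future_domain U x ->
    a (time x) (space_r (space x)) / time x ^+ 2 != 0.
  by move=> [t0 _]; rewrite gt_eqF// divr_gt0 ?exprn_gt0 ?a_gt0.
split=> // u w w_C2 uw.
suff E x : future_domain U x -> heat_operator (cone_metric h) u x =
    a (time x) (space_r (space x)) / time x ^+ 2 *
    laplacian (cone_metric h) w (new_coords2 x).
  split=> //; exact: reduced_equation_equiv new_coords2_image mu0 E.
move=> Dx; have [t_gt0 [r_gt0 Uy]] := Dx.
have zE x' : new_coords2 x' =
    cone_point ((time x')^-1 * space_r (space x')) (space_y (space x')).
  by rewrite mulrC.
have c_gt0 (t : R) : 0 < t -> 0 < t^-1 by rewrite invr_gt0.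
have c_derive (t : R) : 0 < t ->
    is_derive t (1 : R) (fun t => t^-1 : R^o) (- t ^- 2).
  move=> t0; have Dt := is_derive_id t (1 : R^o).
  apply: (is_derive_eq (is_derive_inv (f := id) (lt0r_neq0 t0) Dt)).
  exact: mulr1.
have a_derive (t r : R) : 0 < t -> 0 < r ->
    is_derive r (1 : R) (a t : R -> R^o) (- (r / (2 * t)) * a t r).
  move=> t0 r0; have Dr := is_derive_id r (1 : R^o).
  have De := is_derive_comp_real (f := fun r : R => - (r ^+ 2 / (4 * t)) : R^o)
    (is_derive_expR _) (is_derive_opp (is_derive_mul (is_derive_pow 2 Dr)
      (is_derive_cst ((4 * t)^-1 : R^o) _ _))).
  rewrite /a; differentiate.
  move: (expR _) (_ `^ _)^-1 => p q.
  by field; rewrite gt_eqF.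
have a1_derive (t r : R) : 0 < t -> 0 < r ->
    is_derive r (1 : R) (fun r => - (r / (2 * t)) * a t r : R^o)
      ((r ^+ 2 / (4 * t ^+ 2) - (2 * t)^-1) * a t r).
  move=> t0 r0; have Dr := is_derive_id r (1 : R^o).
  have Da := a_derive t r t0 r0.
  differentiate; move: (a t r) => p.
  by field; rewrite gt_eqF.
have a_t_derive (t r : R) : 0 < t -> 0 < r ->
    is_derive t (1 : R) (a ^~ r : R -> R^o)
      ((r ^+ 2 / (4 * t ^+ 2) - n%:R / (2 * t)) * a t r).
  move=> t0 r0; have Dt := is_derive_id t (1 : R^o).
  have t4_neq0 : 4 * t != 0 by rewrite mulf_neq0 ?gt_eqF.
  have Dt4v := is_derive_inv (f := fun t : R => 4 * t : R^o)
    t4_neq0 (is_derive_scale 4 Dt).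
  have De := is_derive_comp_real (f := fun t : R => - (r ^+ 2 / (4 * t)) : R^o)
    (is_derive_expR _) (is_derive_opp (is_derive_scale (r ^+ 2) Dt4v)).
  have p_gt0 : 0 < t `^ (n%:R / 2) by rewrite powR_gt0.
  have Dp := is_derive_inv (f := fun t : R => t `^ (n%:R / 2) : R^o)
    (lt0r_neq0 p_gt0) (is_derive_powR (n%:R / 2) t0).
  rewrite /a; differentiate.
  move: p_gt0; move: (expR _) (_ `^ _) => p q q_gt0.
  by field; rewrite !gt_eqF.
have uE x' : future_domain U x' -> u x' = a (time x') (space_r (space x')) *
    w (cone_point ((time x')^-1 * space_r (space x')) (space_y (space x'))).
  move=> Dx'; have [t0 _] := Dx'.
  rewrite -zE uw// /new_unknown2 /a /= expRN.
  have p_gt0 : 0 < time x' `^ (n%:R / 2) by rewrite powR_gt0.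
  have := expR_gt0 (space_r (space x') ^+ 2 / (4 * time x')).
  move: p_gt0; move: (expR _) (_ `^ _) => p q q_gt0 p_gt0.
  by field; rewrite !gt_eqF.
rewrite (heat_operator_similarity w_C2 c_gt0 c_derive a_derive a1_derive
  a_t_derive uE Dx) -zE natr_pred ?(ltnW (ltnW n_gt2))//.
move: (laplacian _ w _) (partial radial w _) (w _) => p0 p1 p2.
move: (a _ _) => p3.
by field; rewrite !gt_eqF.
Qed.

End HeatReduction.

Theorem proposition5 (R : realType) (n : nat) (n_gt2 : (2 < n)%N)
    (U : set 'rV[R]_n.-1) (U_open : open U)
    (h : 'rV[R]_n.-1 -> 'M[R]_n.-1) (h_metric : pseudo_metric_on U h) :
  (homothetic_vector (cone_domain U) (cone_metric h) radial_field /\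
   gradient_vector (cone_domain U) (cone_metric h) radial_field) /\
  (forall u : 'rV[R]_(1 + (1 + n.-1)) -> R^o,
     class_C 2 (spacetime_domain U) u ->
     forall x, spacetime_domain U x ->
       heat_operator (cone_metric h) u x = heat_jet h (jet2_of u x)) /\
  (lie_point_symmetry (spacetime_domain U) (heat_jet h) X1 /\
   lie_point_symmetry (spacetime_domain U) (heat_jet h) X2) /\
  reduces_by X1 (future_domain U) (heat_operator (cone_metric h))
    new_coords1 new_unknown1
    (cone_domain U) (laplacian (conformal_cone_metric h)) /\
  reduces_by X2 (future_domain U) (heat_operator (cone_metric h))
    new_coords2 new_unknown2
    (cone_domain U) (laplacian (cone_metric h)).
Proof.
split; first by split; [exact: radial_field_homothetic|exact: radial_field_gradient].
split.
  by move=> u u_C2 x Dx; exact: (heat_operatorE (ltnW (ltnW n_gt2)) U_open h_metric).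
split; last by split; [exact: reduces_by_X1|exact: reduces_by_X2].
by split; rewrite ?X1_heat_field ?X2_heat_field; exact: heat_field_symmetry.
Qed.
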